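(* Let $\alpha>0$, $\beta>0$, $1\le p\le\infty$, $0<a<b<\infty$, and let $\rho\in\mathbb{R}$, $\rho\neq-1$, and $c\in\mathbb{R}$ be such that $\rho\ge c$. Then for every $f\in X^p_c(a,b)$ the semigroup property holds: $${}^{\rho}_{a}I^{\alpha}\left({}^{\rho}_{a}I^{\beta}f\right)={}^{\rho}_{a}I^{\alpha+\beta}f ,$$ as an equality of elements of $X^p_c(a,b)$ (i.e. almost everywhere on $[a,b]$).
   Context: For $c\in\mathbb{R}$ and $1\le p\le\infty$, $X^p_c(a,b)$ is the space of complex-valued Lebesgue measurable functions $f$ on $[a,b]$ (identified when equal almost everywhere) with $\|f\|_{X^p_c}<\infty$, where $$\|f\|_{X^p_c}=\left(\int_a^b|t^cf(t)|^p\,\frac{dt}{t}\right)^{1/p}\quad(1\le p<\infty),\qquad \|f\|_{X^\infty_c}=\operatorname{ess\,sup}_{a\le t\le b}\,t^c|f(t)|.$$ For $\rho\ne-1$, the generalized fractional integral of order $\alpha>0$ with parameter $\rho$ is $$({}^{\rho}_{a}I^{\alpha}f)(x)=\frac{(\rho+1)^{1-\alpha}}{\Gamma(\alpha)}\int_a^x(x^{\rho+1}-\tau^{\rho+1})^{\alpha-1}\tau^{\rho}f(\tau)\,d\tau,\qquad a<x<b,$$ where the product $(\rho+1)^{1-\alpha}(x^{\rho+1}-\tau^{\rho+1})^{\alpha-1}$ is understood as $\left(\frac{x^{\rho+1}-\tau^{\rho+1}}{\rho+1}\right)^{\alpha-1}$, a real power of a positive number for $\tau<x$. *)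

(* Defs.v *)
From HB Require Import structures.
From mathcomp Require Import all_boot all_order all_algebra.
From mathcomp Require Import all_classical all_reals all_analysis.
From mathcomp Require Import ess_sup_inf hoelder.
From mathcomp Require Import complex.

Set Implicit Arguments.
Unset Strict Implicit.
Unset Printing Implicit Defensive.

Import Order.TTheory GRing.Theory Num.Theory.
Import numFieldNormedType.Exports.

Local Open Scope classical_set_scope.
Local Open Scope ring_scope.
Local Open Scope complex_scope.

(* [R] equipped with the (complete) sigma-algebra of Lebesgue measurable sets;
   the canonical measurable structure on [R] itself is the Borel one. *)
Notation lebesgueType R :=
  (caratheodory_type (R := R) (T := ocitv_type R) (wlength idfun)^*%mu).

Section FractionalIntegral.
Context {R : realType}.

Local Notation lambda := (@completed_lebesgue_measure R).

Definition Gamma (z : R) : R :=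
  \int[lambda]_(t in `]0, +oo[) (t `^ (z - 1) * expR (- t)).

Definition cmeasurable (D : set R) (f : R -> R[i]) : Prop :=
  measurable_fun (D : set (lebesgueType R))
    ((fun t => complex.Re (f t)) : lebesgueType R -> R) /\
  measurable_fun (D : set (lebesgueType R))
    ((fun t => complex.Im (f t)) : lebesgueType R -> R).

Definition cintegrable (D : set R) (f : R -> R[i]) : Prop :=
  lambda.-integrable D (EFin \o (fun t => complex.Re (f t))) /\
  lambda.-integrable D (EFin \o (fun t => complex.Im (f t))).

(* Meaningful only when [cintegrable D f]. *)
Definition cintegral (D : set R) (f : R -> R[i]) : R[i] :=
  (\int[lambda]_(t in D) complex.Re (f t)) +i*
  (\int[lambda]_(t in D) complex.Im (f t)).

(* In the case [p = +oo], the extension by 0 outside [a, b] makes this the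
   essential supremum over [a, b], the function being nonnegative. The value
   at [p = -oo] is a dummy one: the exponent always satisfies [1 <= p]. *)
Definition Xnorm (p : \bar R) (c a b : R) (f : R -> R[i]) : \bar R :=
  match p with
  | r%:E => ((\int[lambda]_(t in `[a, b])
      (Normc.normc ((t `^ c)%:C * f t) `^ r / t)%:E) `^ r^-1)%E
  | +oo%E => ess_sup lambda
      (EFin \o ((fun t => t `^ c * Normc.normc (f t)) \_ `[a, b]))
  | -oo%E => +oo%E
  end.

(* The functions representing the elements of the space X^p_c(a,b). *)
Definition Xspace (p : \bar R) (c a b : R) : set (R -> R[i]) :=
  [set f | cmeasurable `[a, b] f /\ (Xnorm p c a b f < +oo)%E].

Definition frac_integrand (rho alpha : R) (f : R -> R[i]) (x tau : R) : R[i] :=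
  (((x `^ (rho + 1) - tau `^ (rho + 1)) / (rho + 1)) `^ (alpha - 1)
     * tau `^ rho)%:C * f tau.

Definition frac_int (rho a alpha : R) (f : R -> R[i]) (x : R) : R[i] :=
  (Gamma alpha)^-1%:C * cintegral `]a, x[ (frac_integrand rho alpha f x).

(* The integral defining [frac_int rho a alpha f] converges absolutely at
   almost every point of [a, b]. *)
Definition frac_int_defined (rho a b alpha : R) (f : R -> R[i]) : Prop :=
  {ae lambda, forall x, x \in `[a, b] ->
     cintegrable `]a, x[ (frac_integrand rho alpha f x)}.

End FractionalIntegral.

(* Main.v *)
Require Import Defs.
From HB Require Import structures.
From mathcomp Require Import all_boot all_order all_algebra.
From mathcomp Require Import all_classical all_reals all_analysis.
From mathcomp Require Import measurable_realfun ess_sup_inf.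
From mathcomp Require Import complex.
From mathcomp Require Import ring lra.

(** Write [F t = t ^ (rho + 1) / (rho + 1)], so that [F' t = t ^ rho > 0] on the
    positive half-line whatever the sign of [rho + 1]. The operator of order
    [al] is then integration against the kernel
    [(F x - F t) ^ (al - 1) * F' t], divided by [Gamma al].

    The change of variables [u = F t] turns the composition of two such kernels
    into a Beta integral, so that the kernels of order [al] and [be] compose to
    [Gamma al * Gamma be / Gamma (al + be)] times the kernel of order [al + be]
    ([frac_kernel_comp]). The substitution has to allow integrands that blow up
    at both ends ([ge0_integration_by_substitution_oo]), and the value of the
    Beta integral comes from a double integral computed in two orders
    ([gamma_beta_integral]).

    Since [0 < a] and [b] is finite, the weights [t ^ c] and [1 / t] are bounded
    above and away from [0] on [a, b]: membership in the weighted space says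
    that the real and imaginary parts are in the unweighted L^p of [a, b]
    ([XspaceP]), and in particular are integrable. The kernel has uniformly
    bounded row and column integrals ([frac_kernel_schur]), so by Schur's test
    the operator is defined almost everywhere on integrable functions
    ([ae_kernel_integrable]) and preserves L^p ([lp_finite_kop]). The semigroup
    property is Fubini's theorem: at almost every point the iterated integral
    converges absolutely, because its absolute version is a multiple of the
    integral of order [al + be] of [|f|] ([kop_comp]). *)

Set Implicit Arguments.
Unset Strict Implicit.
Unset Printing Implicit Defensive.

Import Order.TTheory GRing.Theory Num.Theory.
Import numFieldNormedType.Exports.

Local Open Scope classical_set_scope.
Local Open Scope ring_scope.

(** * Integral operators with nonnegative kernels *)

Lemma measurable_comp_powR d (T : measurableType d) (R : realType) (D : set T)
    (g : T -> R) z :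
  measurable_fun D g -> measurable_fun D (fun t => g t `^ z).
Proof. by move=> mg; exact: (measurableT_comp (measurable_powR z) mg). Qed.

Lemma measurable_powR_norm d (T : measurableType d) (R : realType)
    (v : T -> R) r :
  measurable_fun [set: T] v ->
  measurable_fun [set: T] (fun x => `|v x| `^ r).
Proof. by move=> mv; apply: measurable_comp_powR; exact: measurableT_comp. Qed.

Section KernelOperator.
Context d (T : measurableType d) (R : realType).
Context (mu : {sigma_finite_measure set T -> \bar R}).
Implicit Types (k : T -> T -> R) (u : T -> R).

Definition kop k u (x : T) : R := \int[mu]_y (k x y * u y).

(** The hypotheses of Schur's test, which make [kop k] bounded on every L^p. *)
Record schur_kernel k (M : R) : Prop := SchurKernel {
  schur_bound_gt0 : 0 < M ;
  schur_ge0 : forall x y, 0 <= k x y ;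
  schur_meas : measurable_fun [set: T * T] (fun z => k z.1 z.2) ;
  schur_row : forall x, (\int[mu]_y (k x y)%:E <= M%:E)%E ;
  schur_col : forall y, (\int[mu]_x (k x y)%:E <= M%:E)%E }.

Lemma measurable_kernel_row k M x : schur_kernel k M ->
  measurable_fun [set: T] (k x).
Proof. by move=> [_ _ mk _ _]; exact: (measurableT_comp mk (pair1_measurable x)). Qed.

Lemma measurable_kernel_col k M y : schur_kernel k M ->
  measurable_fun [set: T] (k ^~ y).
Proof. by move=> [_ _ mk _ _]; exact: (measurableT_comp mk (pair2_measurable y)). Qed.

Lemma measurable_kernel_mul k M u : schur_kernel k M ->
  measurable_fun [set: T] u ->
  measurable_fun [set: T * T] (fun z => k z.1 z.2 * u z.2).
Proof.
move=> [_ _ mk _ _] mu_; apply: measurable_funM => //.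
exact: (measurableT_comp mu_ measurable_snd).
Qed.

(** Integrating in [x] first, as Tonelli's theorem allows, meets only the bound
    on the columns. *)
Lemma kernel_integral_le k M (w : T -> R) : schur_kernel k M ->
  measurable_fun [set: T] w -> (forall y, 0 <= w y) ->
  (\int[mu]_x \int[mu]_y (k x y * w y)%:E <= M%:E * \int[mu]_y (w y)%:E)%E.
Proof.
move=> sk mw w0; have [M0 k0 mk _ kc] := sk.
have mkw := measurable_kernel_mul sk mw.
have kw0 z : (0 <= (k z.1 z.2 * w z.2)%:E)%E by rewrite lee_fin mulr_ge0.
rewrite (fubini_tonelli (fun z => (k z.1 z.2 * w z.2)%:E))//=; last first.
  exact/measurable_EFinP.
rewrite -ge0_integralZl//; last 3 first.
- exact/measurable_EFinP.
- by move=> y _; rewrite lee_fin.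
- exact: ltW.
apply: ge0_le_integral => //.
- by move=> y _; apply: integral_ge0 => x _; rewrite lee_fin mulr_ge0.
- apply: (measurable_fun_fubini_tonelli_G (fun z => (k z.1 z.2 * w z.2)%:E)) => //.
  exact/measurable_EFinP.
- by apply: emeasurable_funM => //; exact/measurable_EFinP.
- move=> y _; under eq_integral do rewrite EFinM.
  rewrite ge0_integralZr//; last 3 first.
  + exact/measurable_EFinP/(measurable_kernel_col y sk).
  + by move=> x _; rewrite lee_fin.
  + by rewrite lee_fin.
  + by rewrite lee_wpmul2r ?lee_fin.
Qed.

Lemma kernel_integrable_prod k M u : schur_kernel k M ->
  mu.-integrable [set: T] (EFin \o u) ->
  (mu \x mu)%E.-integrable [set: T * T] (fun z => (k z.1 z.2 * u z.2)%:E).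
Proof.
move=> sk iu; have [M0 k0 mk _ kc] := sk.
have mu' : measurable_fun [set: T] u by exact/measurable_EFinP/measurable_int/iu.
apply/integrable12ltyP.
  by apply/measurable_EFinP; exact: (measurable_kernel_mul sk mu').
under eq_integral do under eq_integral do rewrite /= normrM ger0_norm//.
have mnu : measurable_fun [set: T] (fun y => `|u y|) by exact: measurableT_comp.
apply: (le_lt_trans (kernel_integral_le sk mnu _)); first by move=> y; exact: normr_ge0.
move/integrableP : iu => [_ iu].
by rewrite lte_mul_pinfty// ?lee_fin ?(ltW M0)// integral_ge0.
Qed.

Lemma ae_kernel_integrable k M u : schur_kernel k M ->
  mu.-integrable [set: T] (EFin \o u) ->
  {ae mu, forall x, mu.-integrable [set: T] (fun y => (k x y * u y)%:E)}.
Proof. by move=> sk iu; exact: (ae_integrable1 (kernel_integrable_prod sk iu)). Qed.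

Lemma measurable_kop k M u : schur_kernel k M ->
  mu.-integrable [set: T] (EFin \o u) -> measurable_fun [set: T] (kop k u).
Proof.
move=> sk iu; rewrite /kop /Rintegral.
apply: (measurableT_comp (fine_measurable measurableT)).
exact: (measurable_fubini_F (kernel_integrable_prod sk iu)).
Qed.

Lemma le_kop k M u x C : schur_kernel k M -> measurable_fun [set: T] u ->
  0 <= C -> {ae mu, forall y, `|u y| <= C} ->
  `|kop k u x| <= C * M.
Proof.
move=> sk mu' C0 uC; have [M0 k0 mk kr _] := sk.
have mku : measurable_fun [set: T] (fun y => k x y * u y).
  by apply: measurable_funM => //; exact: measurable_kernel_row sk.
have mkx : measurable_fun [set: T] (fun y => (k x y)%:E).
  exact/measurable_EFinP/(measurable_kernel_row x sk).
have ub : (\int[mu]_y `|k x y * u y|%:E <= (C * M)%:E)%E.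
  apply: (@le_trans _ _ (\int[mu]_y (C%:E * (k x y)%:E))%E); last first.
    rewrite ge0_integralZl//; last by move=> y _; rewrite lee_fin.
    by rewrite EFinM lee_wpmul2l ?lee_fin.
  apply: ae_ge0_le_integral => //.
  - by apply/measurable_EFinP; exact: measurableT_comp.
  - by move=> y _; rewrite mule_ge0 ?lee_fin.
  - exact: emeasurable_funM.
  - apply: filterS uC => y uC _.
    by rewrite -EFinM lee_fin normrM ger0_norm// mulrC ler_wpM2r.
have iku : mu.-integrable [set: T] (EFin \o (fun y => k x y * u y)).
  apply/integrableP; split; first exact/measurable_EFinP.
  by rewrite (le_lt_trans ub)// ltry.
apply: (le_trans (le_normr_Rintegral _ iku)) => //.
rewrite /Rintegral -lee_fin fineK//; apply: integrable_fin_num => //.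
exact: integrable_abse iku.
Qed.

(** Either [t <= m], or [t = t ^ r * t ^ (1 - r)] with [t ^ (1 - r)] at most
    [m ^ (1 - r)]. Used with a level [m] depending on the point, this linear
    bound replaces Hoelder's inequality, and covers [r = 1] as well. *)
Lemma le_powR_cut (r m t : R) : 1 <= r -> 0 < m -> 0 <= t ->
  t <= m + m `^ (1 - r) * t `^ r.
Proof.
move=> r1 m0 t0; have [tm|mt] := leP t m.
  by rewrite (le_trans tm)// lerDl mulr_ge0// powR_ge0.
have t0' : 0 < t by exact: lt_trans mt.
apply: (@le_trans _ _ (m `^ (1 - r) * t `^ r)); last by rewrite lerDr ltW.
have -> : t `^ r = t `^ (r - 1) * t.
  by rewrite mulrC mulr_powRB1 ?(lt_le_trans _ r1).
rewrite mulrA ler_peMl// -opprB powRN mulrC ler_pdivlMr ?powR_gt0// mul1r.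
by rewrite ge0_ler_powR ?nnegrE ?subr_ge0// ltW.
Qed.

(** Integrate [le_powR_cut] against [k x] with [m = A / (2 M)], where
    [A = |kop k u x|]: the contribution of the constant [m] is at most [A / 2]
    and is absorbed by the left-hand side. *)
Lemma kop_powR_le k M u r x : schur_kernel k M -> 1 <= r ->
  measurable_fun [set: T] u ->
  mu.-integrable [set: T] (fun y => (k x y * u y)%:E) ->
  ((`|kop k u x| `^ r)%:E <= (2 * (2 * M) `^ (r - 1))%:E *
     \int[mu]_y (k x y * `|u y| `^ r)%:E)%E.
Proof.
move=> sk r1 mu' iku; have [M0 k0 mk kr _] := sk.
set A := `|kop k u x|; set B := (\int[mu]_y _)%E.
have r0 : 0 < r by exact: lt_le_trans r1.
have mw := measurable_powR_norm r mu'.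
have mkx := measurable_kernel_row x sk.
have B0 : (0 <= B)%E.
  by apply: integral_ge0 => y _; rewrite lee_fin mulr_ge0// powR_ge0.
have C0 : 0 < 2 * (2 * M) `^ (r - 1) by rewrite mulr_gt0// powR_gt0// mulr_gt0.
have [A0|A0] := eqVneq A 0.
  by rewrite A0 powR0 ?gt_eqF// mule_ge0// lee_fin ltW.
have Agt0 : 0 < A by rewrite lt_def A0 normr_ge0.
pose m := A / (2 * M).
have m0 : 0 < m by rewrite divr_gt0// mulr_gt0.
have AB : (A%:E <= (m * M)%:E + (m `^ (1 - r))%:E * B)%E.
  apply: (@le_trans _ _ (\int[mu]_y (m%:E * (k x y)%:E +
      (m `^ (1 - r))%:E * (k x y * `|u y| `^ r)%:E))%E); last first.
    rewrite ge0_integralD//; last 4 first.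
    - by move=> y _; rewrite mule_ge0 ?lee_fin ?(ltW m0).
    - by apply: emeasurable_funM => //; exact/measurable_EFinP.
    - by move=> y _; rewrite mule_ge0 ?lee_fin ?powR_ge0// mulr_ge0 ?powR_ge0.
    - apply: emeasurable_funM => //; apply/measurable_EFinP.
      exact: measurable_funM.
    rewrite ge0_integralZl_EFin//; last 3 first.
    - by move=> y _; rewrite lee_fin.
    - exact/measurable_EFinP.
    - exact: ltW.
    rewrite ge0_integralZl_EFin//; last 3 first.
    - by move=> y _; rewrite lee_fin mulr_ge0 ?powR_ge0.
    - by apply/measurable_EFinP; exact: measurable_funM.
    - exact: powR_ge0.
    by rewrite leeD2r// [(m * M)%:E]EFinM lee_wpmul2l// lee_fin ltW.
  apply: (@le_trans _ _ (\int[mu]_y `|k x y * u y|%:E)%E).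
    have := le_normr_Rintegral measurableT iku.
    rewrite -lee_fin => /le_trans; apply.
    rewrite /Rintegral fineK//; apply: integrable_fin_num => //.
    exact: integrable_abse iku.
  apply: ge0_le_integral => //.
  - apply/measurable_EFinP; apply: measurableT_comp => //.
    exact: measurable_funM.
  - apply: emeasurable_funD; apply: emeasurable_funM => //; apply/measurable_EFinP => //.
    exact: measurable_funM.
  - move=> y _; rewrite -!EFinM -EFinD lee_fin normrM ger0_norm//.
    rewrite [m * _]mulrC [X in _ <= _ + X]mulrCA -mulrDr ler_wpM2l//.
    exact: le_powR_cut.
have [->|Bfin] := eqVneq B +oo%E.
  by rewrite gt0_muley ?lte_fin// leey.
have {}Bfin : B \is a fin_num by rewrite ge0_fin_numE// lt_neqAle Bfin leey.
move: AB B0; rewrite -(fineK Bfin) -!EFinM -EFinD !lee_fin => AB B0.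
have mM : m * M = A / 2 by rewrite /m; field; rewrite gt_eqF.
have h : A / 2 <= m `^ (1 - r) * fine B by rewrite mM in AB; lra.
have -> : A `^ r = A * A `^ (r - 1).
  by rewrite mulr_powRB1// ltW.
have -> : A `^ (r - 1) = (2 * M) `^ (r - 1) * m `^ (r - 1).
  by rewrite -powRM ?ltW// ?mulr_gt0// /m mulrC divfK// mulf_neq0 ?gt_eqF.
rewrite [leLHS](_ : _ = 2 * (2 * M) `^ (r - 1) * (A / 2 * m `^ (r - 1))); last by field.
rewrite ler_pM2l// -ler_pdivlMr ?powR_gt0// (le_trans h)//.
by rewrite -opprB powRN mulrC.
Qed.

(** Schur's test: the pointwise bound [kop_powR_le] uses the rows, its integral
    uses the columns. *)
Lemma kop_Lp k M u r : schur_kernel k M -> 1 <= r ->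
  mu.-integrable [set: T] (EFin \o u) ->
  (\int[mu]_y (`|u y| `^ r)%:E < +oo)%E ->
  (\int[mu]_x (`|kop k u x| `^ r)%:E < +oo)%E.
Proof.
move=> sk r1 iu ur; have [M0 k0 mk kr _] := sk.
have mu' : measurable_fun [set: T] u by exact/measurable_EFinP/measurable_int/iu.
have mw := measurable_powR_norm r mu'.
pose C := 2 * (2 * M) `^ (r - 1).
have C0 : 0 <= C by rewrite mulr_ge0// powR_ge0.
pose Bx x := (\int[mu]_y (k x y * `|u y| `^ r)%:E)%E.
have B0 x : (0 <= Bx x)%E.
  by apply: integral_ge0 => y _; rewrite lee_fin mulr_ge0// powR_ge0.
have mB : measurable_fun [set: T] Bx.
  apply: (measurable_fun_fubini_tonelli_F (fun z => (k z.1 z.2 * `|u z.2| `^ r)%:E)).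
    by apply/measurable_EFinP; exact: (measurable_kernel_mul sk mw).
  by move=> z; rewrite lee_fin mulr_ge0// powR_ge0.
apply: (@le_lt_trans _ _ (\int[mu]_x (C%:E * Bx x))%E).
  apply: ae_ge0_le_integral => //.
  - apply/measurable_EFinP; apply: (measurableT_comp (measurable_powR r)).
    by apply: measurableT_comp => //; exact: (measurable_kop sk).
  - by move=> x _; rewrite mule_ge0.
  - exact: emeasurable_funM.
  - apply: filterS (ae_kernel_integrable sk iu) => x ix _.
    exact: kop_powR_le.
rewrite ge0_integralZl//.
rewrite lte_mul_pinfty ?lee_fin// (le_lt_trans (kernel_integral_le sk mw _))//.
rewrite lte_mul_pinfty ?lee_fin ?(ltW M0)// integral_ge0// => y _.
Qed.

Lemma kop_scale k u (s : R) x :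
  mu.-integrable [set: T] (fun y => (k x y * u y)%:E) ->
  kop k (fun y => s * u y) x = s * kop k u x.
Proof.
move=> iku; rewrite /kop -RintegralZl//.
by apply: eq_Rintegral => y _; rewrite mulrCA.
Qed.

(** Fubini's theorem applies at [x] as soon as [k3 x y * u y] is integrable in
    [y], hence almost everywhere: integrating [k1 x t * k2 t y * |u y|] in [t]
    first gives [C * k3 x y * |u y|]. *)
Lemma kop_comp k1 k2 k3 M1 M2 M3 C u :
  schur_kernel k1 M1 -> schur_kernel k2 M2 -> schur_kernel k3 M3 ->
  0 <= C -> (forall x y, \int[mu]_t (k1 x t * k2 t y)%:E = (C * k3 x y)%:E)%E ->
  mu.-integrable [set: T] (EFin \o u) ->
  {ae mu, forall x, kop k1 (kop k2 u) x = C * kop k3 u x}.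
Proof.
move=> s1 s2 s3 C0 k123 iu.
have mu' : measurable_fun [set: T] u by exact/measurable_EFinP/measurable_int/iu.
apply: filterS (ae_kernel_integrable s3 iu) => x ix.
have [_ k10 _ _ _] := s1; have [_ k20 mk2 _ _] := s2.
have [_ k30 _ _ _] := s3.
have mk1x := measurable_kernel_row x s1.
pose f (z : T * T) := (k1 x z.1 * (k2 z.1 z.2 * u z.2))%:E.
have mf : measurable_fun [set: T * T] f.
  apply/measurable_EFinP; apply: measurable_funM.
    exact: (measurableT_comp mk1x measurable_fst).
  exact: (measurable_kernel_mul s2 mu').
have mk2c y : measurable_fun [set: T] (fun t => k1 x t * k2 t y).
  by apply: measurable_funM => //; exact: (measurable_kernel_col y s2).
have if_ : (mu \x mu)%E.-integrable [set: T * T] f.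
  apply/integrable21ltyP => //.
  have -> : (\int[mu]_y \int[mu]_t `|f (t, y)| =
             \int[mu]_y (C%:E * `|(k3 x y * u y)%:E|))%E.
    apply: eq_integral => y _.
    under eq_integral => t _.
      rewrite /f/= mulrA normrM (ger0_norm (mulr_ge0 (k10 _ _) (k20 _ _))).
      rewrite EFinM; over.
    rewrite ge0_integralZr//; last 2 first.
    - exact/measurable_EFinP.
    - by move=> t _; rewrite lee_fin mulr_ge0.
    by rewrite k123 /= normrM (ger0_norm (k30 _ _)) -!EFinM mulrA.
  have /integrableP[mix ix'] := ix.
  rewrite ge0_integralZl_EFin//; last exact: measurableT_comp.
  by rewrite lte_mul_pinfty ?lee_fin// integral_ge0.
have Fub := Fubini if_.
rewrite /kop /Rintegral.
have -> : (\int[mu]_y (k1 x y * fine (\int[mu]_y0 (k2 y y0 * u y0)%:E))%:E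
   = \int[mu]_t \int[mu]_y f (t, y))%E.
  apply: ae_eq_integral; first exact: measurableT.
  - apply/measurable_EFinP; apply: measurable_funM; first exact: mk1x.
    exact: (measurable_kop s2 iu).
  - exact: (measurable_fubini_F if_).
  - apply: filterS (ae_kernel_integrable s2 iu) => t it _.
    rewrite /f /=; under [RHS]eq_integral do rewrite EFinM.
    rewrite (integralZl measurableT it) EFinM fineK//.
    exact: (integrable_fin_num measurableT it).
rewrite Fub.
have -> : (\int[mu]_y \int[mu]_t f (t, y) = \int[mu]_y (C%:E * (k3 x y * u y)%:E))%E.
  apply: eq_integral => y _.
  under eq_integral do rewrite /f /= mulrA EFinM.
  rewrite (integralZr measurableT).
    by rewrite k123 -!EFinM mulrA.
  apply/integrableP; split; first exact/measurable_EFinP.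
  under eq_integral => t _ do rewrite /= (ger0_norm (mulr_ge0 (k10 _ _) (k20 _ _))).
  by rewrite k123 ltry.
by rewrite (integralZl measurableT ix) fineM// (integrable_fin_num measurableT ix).
Qed.

End KernelOperator.

(** * Finiteness of L^p norms *)

Section LpFinite.
Context d (T : measurableType d) (R : realType).
Context (mu : {sigma_finite_measure set T -> \bar R}).
Implicit Types (p : \bar R) (v : T -> R).

Definition lp_finite p v : Prop :=
  match p with
  | r%:E => (\int[mu]_x (`|v x| `^ r)%:E < +oo)%E
  | +oo%E => exists C, 0 <= C /\ {ae mu, forall x, `|v x| <= C}
  | -oo%E => True
  end.

Lemma lp_finite_scale p v (k : R) : measurable_fun [set: T] v ->
  lp_finite p v -> lp_finite p (fun x => k * v x).
Proof.
case: p => [r| |] mv; [|move=> /=|by []]; last first.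
  move=> [C [C0 vC]]; exists (`|k| * C); split; first by rewrite mulr_ge0.
  by apply: filterS vC => x vC; rewrite normrM ler_wpM2l.
move=> /= h; under eq_integral do rewrite normrM powRM// EFinM.
rewrite ge0_integralZl_EFin//.
- by rewrite lte_mul_pinfty ?lee_fin ?powR_ge0// integral_ge0.
- by apply/measurable_EFinP; exact: measurable_powR_norm.
Qed.

Lemma lp_finite_kop p k M u : schur_kernel mu k M -> (1 <= p)%E ->
  mu.-integrable [set: T] (EFin \o u) ->
  lp_finite p u -> lp_finite p (kop mu k u).
Proof.
case: p => [r| |] sk p1 iu; [|move=> /=|by []].
  by rewrite lee_fin in p1; exact: (kop_Lp sk p1 iu).
have mu' : measurable_fun [set: T] u by exact/measurable_EFinP/measurable_int/iu.
move=> [C [C0 uC]]; exists (C * M); have [M0 _ _ _ _] := sk.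
by split; [rewrite mulr_ge0// ltW|apply: nearW => x; exact: le_kop].
Qed.

(** Where [D] has finite measure, [|v| <= 1 + |v| ^ r] and bounded functions are
    integrable. *)
Lemma lp_finite_integrable p v (D : set T) : measurable D -> (mu D < +oo)%E ->
  measurable_fun [set: T] v -> (forall x, ~ D x -> v x = 0) ->
  (1 <= p)%E -> lp_finite p v -> mu.-integrable [set: T] (EFin \o v).
Proof.
move=> mD Dfin mv v0 p1 lpv; apply/integrableP; split; first exact/measurable_EFinP.
have mav : measurable_fun [set: T] (fun x => `|v x|) by exact: measurableT_comp.
case: p p1 lpv => [r||]//=; last first.
  move=> _ [C [C0 vC]].
  apply: (@le_lt_trans _ _ (\int[mu]_x (C * \1_D x)%:E)%E).
    apply: ae_ge0_le_integral => //.
    - by apply/measurable_EFinP.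
    - by move=> x _; rewrite lee_fin mulr_ge0.
    - by apply/measurable_EFinP; apply: measurable_funM.
    apply: filterS vC => x vC _; rewrite lee_fin indicE.
    have [xD|xD] := boolP (x \in D); first by rewrite mulr1.
    by rewrite mulr0 v0 ?normr0//; move: xD; rewrite notin_setE.
  under eq_integral do rewrite EFinM.
  rewrite ge0_integralZl_EFin//; last exact/measurable_EFinP.
  by rewrite integral_indic// setIT lte_mul_pinfty ?lee_fin.
rewrite lee_fin => r1 vr.
apply: (@le_lt_trans _ _ (\int[mu]_x ((\1_D x)%:E + (`|v x| `^ r)%:E))%E).
  apply: ge0_le_integral => //.
  - by apply/measurable_EFinP.
  - apply: emeasurable_funD; apply/measurable_EFinP => //.
    exact: measurable_powR_norm.
  move=> x _; rewrite -EFinD lee_fin indicE.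
  have [xD|xD] := boolP (x \in D); last first.
    by rewrite v0 ?normr0 ?addr_ge0 ?powR_ge0//; move: xD; rewrite notin_setE.
  have [v1|v1] := leP `|v x| 1; first by rewrite (le_trans v1)// lerDl powR_ge0.
  by rewrite -[leLHS]add0r lerD// le1r_powR// ltW.
rewrite ge0_integralD//; last 2 first.
- by apply/measurable_EFinP.
- by apply/measurable_EFinP; exact: measurable_powR_norm.
by rewrite lte_add_pinfty// integral_indic// setIT.
Qed.

End LpFinite.

(** * Substitution in integrals over open intervals *)

Section Substitution.
Context {R : realType}.
Local Notation leb := (@lebesgue_measure R).
Implicit Types (F f G : R -> R) (a b : R).

Lemma is_derive_near_derive1 F f a b x :
  (forall y : R, y \in `]a, b[ -> is_derive y 1 F (f y)) -> x \in `]a, b[ ->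
  \forall y \near x, derive1 F y = f y.
Proof.
move=> dF xab; have := near_in_itvoo xab; apply: filterS => y yab.
by rewrite derive1E; have /@derive_val := dF _ yab.
Qed.

(** Strictly inside the interval where [F] is continuously differentiable, the
    boundary conditions of the compact substitution theorem are automatic. *)
Lemma integration_by_substitution_cc F f G a b u v :
  (forall y : R, y \in `]a, b[ -> is_derive y 1 F (f y)) ->
  {in `]a, b[, continuous f} -> {in `]a, b[, forall y, 0 < f y} ->
  a < u -> u <= v -> v < b -> {within `[F u, F v], continuous G} ->
  (\int[leb]_(y in `[F u, F v]) (G y)%:E =
   \int[leb]_(y in `[u, v]) (G (F y) * f y)%:E)%E.
Proof.
move=> dF cf f0 au uv vb cG.
have sub x : x \in `[u, v] -> x \in `]a, b[.
  by rewrite !in_itv/= => /andP[ux xv]; rewrite (lt_le_trans au)// (le_lt_trans xv).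
have dFx x : x \in `]a, b[ -> derivable F x 1.
  by move=> xab; have /@ex_derive := dF _ xab.
have F'f x : x \in `]a, b[ -> derive1 F x = f x.
  by move=> xab; rewrite derive1E; have /@derive_val := dF _ xab.
have cF x : x \in `]a, b[ -> {for x, continuous F}.
  by move=> /dFx /derivable1_diffP /differentiable_continuous.
have cF' x : x \in `]a, b[ -> {for x, continuous (derive1 F)}.
  move=> xab; rewrite /prop_for /continuous_at (F'f _ xab).
  apply: cvg_trans (cf _ xab); apply: near_eq_cvg.
  by apply: filterS (is_derive_near_derive1 dF xab) => y ->.
rewrite integration_by_substitution_increasing//; last 5 first.
- have wF : {within `[u, v], continuous F}.
    by apply: derivable_within_continuous => x xuv; exact/dFx/sub.
  apply: gtr0_derive1_lt_cc wF => x /subset_itv_oo_cc xuv; rewrite ?F'f;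
    by [apply: dFx; apply: sub|apply: f0; apply: sub|apply: sub].
- by move=> x /subset_itv_oo_cc xuv; apply: cF'; exact: sub.
- apply/cvg_ex; exists (derive1 F u); apply: cvg_at_right_filter.
  by apply: cF'; apply: sub; rewrite in_itv/= lexx.
- apply/cvg_ex; exists (derive1 F v); apply: cvg_at_left_filter.
  by apply: cF'; apply: sub; rewrite in_itv/= lexx uv.
- split.
  + by move=> x /subset_itv_oo_cc xuv; apply: dFx; exact: sub.
  + by apply: cvg_at_right_filter; apply: cF; apply: sub; rewrite in_itv/= lexx.
  + by apply: cvg_at_left_filter; apply: cF; apply: sub; rewrite in_itv/= lexx uv.
apply: eq_integral => x; rewrite inE/= => xuv.
by rewrite !fctE F'f// sub.
Qed.

Lemma itv_oo_bigcup_cc a b : a < b ->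
  `]a, b[%classic = \bigcup_n `[a + (b - a) / 2 * n.+1%:R^-1,
                        b - (b - a) / 2 * n.+1%:R^-1]%classic.
Proof.
move=> ab; have h0 : 0 < (b - a) / 2 by lra.
apply/seteqP; split => x /=.
- rewrite in_itv/= => /andP[ax xb].
  pose e := Num.min (x - a) (b - x) / ((b - a) / 2).
  have e0 : 0 < e by rewrite divr_gt0// lt_min !subr_gt0 ax.
  have [n _ /(_ n (leqnn n)) ne] := near_infty_natSinv_lt (PosNum e0).
  exists n => //=.
  rewrite /e /= ltr_pdivlMr// lt_min [_^-1 * _]mulrC in ne.
  rewrite in_itv/=; case/andP: ne; set s := _ * n.+1%:R^-1 => h1 h2.
  by apply/andP; split; move: h1 h2; clearbody s; clear; lra.
- case=> n _ /=; rewrite !in_itv/=.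
  have : 0 < (b - a) / 2 * n.+1%:R^-1 by rewrite mulr_gt0// invr_gt0.
  set s := _ * n.+1%:R^-1; clearbody s => s0 /andP[h1 h2].
  by apply/andP; split; lra.
Qed.

(** The open-interval form allows [G] to blow up at the ends, which is what the
    singular kernels below need; it follows from the compact case by
    exhaustion. *)
Lemma ge0_integration_by_substitution_oo F f G a b : a < b ->
  {within `[a, b], continuous F} ->
  (forall y : R, y \in `]a, b[ -> is_derive y 1 F (f y)) ->
  {in `]a, b[, continuous f} -> {in `]a, b[, forall y, 0 < f y} ->
  {in `]F a, F b[, continuous G} -> {in `]F a, F b[, forall y, 0 <= G y} ->
  (\int[leb]_(y in `]F a, F b[) (G y)%:E =
   \int[leb]_(y in `]a, b[) (G (F y) * f y)%:E)%E.
Proof.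
move=> ab cF dF cf f0 cG G0.
have h0 : 0 < (b - a) / 2 by lra.
pose u n : R := a + (b - a) / 2 * n.+1%:R^-1.
pose v n : R := b - (b - a) / 2 * n.+1%:R^-1.
have s0 n : 0 < (b - a) / 2 * n.+1%:R^-1 by rewrite mulr_gt0// invr_gt0.
have s1 n : (b - a) / 2 * n.+1%:R^-1 <= (b - a) / 2.
  by rewrite ler_piMr ?(ltW h0)// invf_le1// ler1n.
have snd m n : (m <= n)%N -> (b - a) / 2 * n.+1%:R^-1 <= (b - a) / 2 * m.+1%:R^-1.
  by move=> mn; rewrite ler_wpM2l ?(ltW h0)// lef_pV2 ?posrE// ler_nat ltnS.
have au n : a < u n by rewrite /u ltrDl.
have vb n : v n < b by rewrite /v gtrBl.
have uv n : u n <= v n.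
  by rewrite /u /v; have := s1 n; set s := _ * n.+1%:R^-1; clearbody s => *; lra.
have incrF : {in `[a, b] &, {homo F : x y / x < y}}.
  apply: gtr0_derive1_lt_cc cF => x xab.
  - by have /@ex_derive := dF _ xab.
  - by rewrite derive1E; have /@derive_val -> := dF _ xab; exact: f0.
have incrFW : {in `[a, b] &, {homo F : x y / x <= y}}.
  move=> x y xab yab; rewrite le_eqVlt => /predU1P[->//|xy].
  by apply/ltW/incrF.
have uab n : u n \in `[a, b].
  by rewrite in_itv/= (ltW (au n)) (le_trans (uv n))// ltW.
have vab n : v n \in `[a, b].
  by rewrite in_itv/= (ltW (vb n)) andbT (le_trans _ (uv n))// ltW.
have aab : a \in `[a, b] by rewrite in_itv/= lexx ltW.
have bab : b \in `[a, b] by rewrite in_itv/= lexx ltW.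
have Fuv n : `[F (u n), F (v n)] `<=` `]F a, F b[.
  apply: subset_itv; rewrite bnd_simp; apply: incrF => //.
have Eab : `]a, b[%classic = \bigcup_n `[u n, v n]%classic by exact: itv_oo_bigcup_cc.
have EFab : `]F a, F b[%classic = \bigcup_n `[F (u n), F (v n)]%classic.
  apply/seteqP; split => [y /=|y [n _ /=]]; last exact: Fuv.
  rewrite in_itv/= => /andP[Fay yFb].
  have Fab : F a <= F b by rewrite ltW// (lt_trans Fay).
  have [|c cab cy] := @IVT R F a b y (ltW ab) cF.
    by rewrite ge_min le_max (ltW Fay) (ltW yFb) orbT.
  have : `]a, b[%classic c.
    move: cab; rewrite /= !in_itv/= => /andP[ac cb].
    rewrite !lt_neqAle ac cb !andbT; apply/andP; split.
      by apply/eqP => aE; rewrite -cy -aE ltxx in Fay.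
    by apply/eqP => bE; rewrite -cy bE ltxx in yFb.
  rewrite Eab => -[n _ /= cn]; exists n => //=.
  rewrite -cy in_itv/=; move: cn; rewrite in_itv/= => /andP[h1 h2].
  by rewrite !incrFW.
have mG n : measurable_fun `[F (u n), F (v n)] G.
  apply: (@measurable_funS _ _ _ _ `]F a, F b[%classic) => //.
  apply: open_continuous_measurable_fun; first exact: interval_open.
  by move=> x; rewrite inE/=; exact: cG.
have cvl : (\int[leb]_(y in `[F (u n), F (v n)]) (G y)%:E)%E @[n --> \oo] -->
   (\int[leb]_(y in `]F a, F b[) (G y)%:E)%E.
  rewrite EFab; apply: ge0_nondecreasing_set_cvg_integral => //.
  - move=> m n mn; rewrite subsetEset; apply: subset_itv; rewrite bnd_simp.
      by apply: incrFW => //; rewrite /u lerD2l snd.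
    by apply: incrFW => //; rewrite /v lerD2l lerN2 snd.
  - by move=> n; apply/measurable_EFinP; exact: mG.
  - by move=> n y /Fuv yn; rewrite lee_fin G0.
have cvr : (\int[leb]_(y in `[u n, v n]) (G (F y) * f y)%:E)%E @[n --> \oo] -->
   (\int[leb]_(y in `]a, b[) (G (F y) * f y)%:E)%E.
  rewrite Eab; apply: ge0_nondecreasing_set_cvg_integral => //.
  - move=> m n mn; rewrite subsetEset; apply: subset_itv; rewrite bnd_simp.
      by rewrite /u lerD2l snd.
    by rewrite /v lerD2l lerN2 snd.
  - move=> n; apply/measurable_EFinP.
    apply: (@measurable_funS _ _ _ _ `]a, b[%classic) => //.
      by rewrite Eab => x xn; exists n.
    apply: open_continuous_measurable_fun; first exact: interval_open.
    move=> x; rewrite inE/= => xab; apply: continuousM; last exact: cf.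
    apply: continuous_comp.
      have /@ex_derive := dF _ xab.
      by move=> /derivable1_diffP /differentiable_continuous.
    apply: cG; move: xab; rewrite !in_itv/= => /andP[ax xb].
    by rewrite !incrF// in_itv/= ?(ltW ax) ?(ltW xb).
  - move=> n y yn; rewrite lee_fin.
    have yab : `]a, b[%classic y by rewrite Eab; exists n.
    rewrite mulr_ge0 ?(ltW (f0 _ _))// G0//.
    move: yab => /=; rewrite !in_itv/= => /andP[ay yb].
    by rewrite !incrF// in_itv/= ?(ltW ay) ?(ltW yb).
have E n : (\int[leb]_(y in `[F (u n), F (v n)]) (G y)%:E =
            \int[leb]_(y in `[u n, v n]) (G (F y) * f y)%:E)%E.
  apply: integration_by_substitution_cc dF cf f0 _ _ _ _ => //.
  apply: continuous_in_subspaceT => x; rewrite inE/= => /Fuv xn.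
  exact: cG.
move: cvl; under eq_fun do rewrite E.
by move=> cvl; exact: (cvg_unique _ cvl cvr).
Qed.

End Substitution.

(** * Beta and Gamma integrals *)

Section BetaGamma.
Context {R : realType}.
Local Notation leb := (@lebesgue_measure R).
Implicit Types (x y z a b : R).

(** Beta and Gamma integrals are taken in the extended reals, so that Tonelli's
    theorem can be used before their finiteness is known. *)
Definition beta_integral x y : \bar R :=
  (\int[leb]_(t in `]0%R, 1%R[) ((1 - t) `^ (x - 1) * t `^ (y - 1))%:E)%E.

Definition gamma_integral z : \bar R :=
  (\int[leb]_(t in `]0%R, +oo[) (t `^ (z - 1) * expR (- t))%:E)%E.

Lemma continuous_powR_gt0 z (t : R) : 0 < t -> {for t, continuous (fun s : R => s `^ z)}.
Proof.
move=> t0; have /@ex_derive := is_derive1_powR z t0.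
by move=> /derivable1_diffP /differentiable_continuous.
Qed.

Lemma continuous_beta_integrand x y a b :
  {in `]a, b[, continuous (fun s : R => (b - s) `^ (x - 1) * (s - a) `^ (y - 1))}.
Proof.
move=> s; rewrite in_itv/= => /andP[as_ sb].
apply: (@continuousM R R (fun s : R => (b - s) `^ (x - 1))
                         (fun s : R => (s - a) `^ (y - 1))).
  apply: (@continuous_comp R R R (fun s : R => b - s) (fun u : R => u `^ (x - 1))).
    by apply: continuousB; [exact: cst_continuous|exact: id].
  by apply: continuous_powR_gt0; rewrite subr_gt0.
apply: (@continuous_comp R R R (fun s : R => s - a) (fun u : R => u `^ (y - 1))).
  by apply: continuousB; [exact: id|exact: cst_continuous].
by apply: continuous_powR_gt0; rewrite subr_gt0.
Qed.

Lemma powR_subr1M x y (l : R) : 0 < l ->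
  l `^ (x - 1) * l `^ (y - 1) * l = l `^ (x + y - 1).
Proof.
move=> l0; rewrite -[X in _ * X = _](powRr1 (ltW l0)) -!powRD ?(gt_eqF l0) ?implybT//.
by congr (_ `^ _); ring.
Qed.

Lemma integral_beta_itv x y a b : a < b ->
  (\int[leb]_(s in `]a, b[) ((b - s) `^ (x - 1) * (s - a) `^ (y - 1))%:E =
   ((b - a) `^ (x + y - 1))%:E * beta_integral x y)%E.
Proof.
move=> ab; pose F (t : R) : R := a + (b - a) * t.
have F0 : F 0 = a by rewrite /F mulr0 addr0.
have F1 : F 1 = b by rewrite /F mulr1 addrC subrK.
have ba0 : 0 < b - a by rewrite subr_gt0.
have dF (t : R) : is_derive t 1 F (b - a).
  rewrite /F; apply: is_derive_eq.
  by rewrite add0r ?(scaler0, mulr0, addr0, add0r) mul1r; exact: mulr1.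
rewrite -{1}F0 -{1}F1 (@ge0_integration_by_substitution_oo R F (fun=> b - a))//.
- rewrite /beta_integral -ge0_integralZl_EFin//; last 3 first.
  + by move=> t _; rewrite lee_fin mulr_ge0// powR_ge0.
  + apply/measurable_EFinP; apply: measurable_funM; apply: measurable_comp_powR => //.
    exact: measurable_funB.
  + exact: powR_ge0.
  apply: eq_integral => t; rewrite inE/= in_itv/= => /andP[t0 t1].
  rewrite -EFinM; congr EFin.
  have -> : b - F t = (b - a) * (1 - t) by rewrite /F; ring.
  have -> : F t - a = (b - a) * t by rewrite /F; ring.
  rewrite !powRM ?ltW// ?subr_gt0// -(powR_subr1M _ _ ba0); ring.
- apply: derivable_within_continuous => t _.
  by have /@ex_derive := dF t.
- by move=> t _; exact: cst_continuous.
- by rewrite F0 F1; exact: continuous_beta_integrand.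
- by move=> t _; rewrite mulr_ge0// powR_ge0.
Qed.

(** The exponents on the right reflect that the affine map from the unit
    interval onto the image of [F] scales each factor, and the measure, by
    [F b - F a]. *)
Lemma integral_beta_substitution (F f : R -> R) x y a b : a < b ->
  {within `[a, b], continuous F} ->
  (forall t : R, t \in `]a, b[ -> is_derive t 1 F (f t)) ->
  {in `]a, b[, continuous f} -> {in `]a, b[, forall t, 0 < f t} ->
  (\int[leb]_(t in `]a, b[)
      ((F b - F t) `^ (x - 1) * (F t - F a) `^ (y - 1) * f t)%:E =
   ((F b - F a) `^ (x + y - 1))%:E * beta_integral x y)%E.
Proof.
move=> ab cF dF cf f0; rewrite -integral_beta_itv; last first.
  have : {in `[a, b] &, {homo F : x y / x < y}}.
    apply: gtr0_derive1_lt_cc cF => t tab.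
    - by have /@ex_derive := dF _ tab.
    - by rewrite derive1E; have /@derive_val -> := dF _ tab; exact: f0.
  by apply; rewrite ?in_itv/= ?lexx ?ltW.
rewrite (@ge0_integration_by_substitution_oo R F f)//.
- exact: continuous_beta_integrand.
- by move=> t _; rewrite mulr_ge0// powR_ge0.
Qed.

Lemma ge0_integral_shift (h : R -> \bar R) (t : R) :
  measurable_fun [set: R] h -> (forall s, 0 <= h s)%E ->
  (\int[leb]_(s in `]t, +oo[) h (s - t)%R = \int[leb]_(s in `]0%R, +oo[) h s)%E.
Proof.
move=> mh h0; pose phi (s : measurableTypeR R) : measurableTypeR R := s - t.
have mphi : measurable_fun [set: measurableTypeR R] phi.
  by apply: measurable_funB.
have -> : `]t, +oo[%classic = phi @^-1` `]0%R, +oo[%classic.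
  by apply/seteqP; split => s /=; rewrite !in_itv/= !andbT subr_gt0.
rewrite -(ge0_integral_pushforward mphi)//=; last exact: measurable_funS mh.
apply: eq_measure_integral => A mA _; apply/esym/lebesgue_measure_unique => //.
move=> _ [[u v]] _ <-; transitivity (leb `]u + t, v + t]%classic).
  rewrite !lebesgue_measure_itv/= !lte_fin ltrD2r; case: ifPn => // _.
  by rewrite -!EFinB; congr EFin; ring.
rewrite /pushforward; congr (leb _).
by apply/seteqP; split => s /=; rewrite !in_itv/= /phi ltrBrDr lerBlDr.
Qed.

End BetaGamma.

Lemma integral_if d (T : measurableType d) (R : realType)
    (mu : {measure set T -> \bar R}) (D : set T) (P : T -> bool) (f : T -> R) :
  (forall x, P x <-> D x) ->
  (\int[mu]_x (if P x then f x else 0)%:E = \int[mu]_(x in D) (f x)%:E)%E.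
Proof.
move=> PD; rewrite [RHS]integral_mkcond; apply: eq_integral => x _.
rewrite patchE; case: ifPn => [/PD xD|/negP xD]; first by rewrite mem_set.
by rewrite memNset// => /PD.
Qed.

Section GammaBeta.
Context {R : realType}.
Local Notation leb := (@lebesgue_measure R).
Implicit Types (x y z a b : R).

Lemma measurable_gamma_integrand z (D : set R) :
  measurable_fun D (fun t : R => t `^ (z - 1) * expR (- t)).
Proof.
apply: measurable_funM; first exact: measurable_comp_powR.
by apply: (measurableT_comp (@measurable_expR R)); exact: measurable_funN.
Qed.

Lemma gamma_integral_ge0 z : (0 <= gamma_integral z)%E.
Proof.
by apply: integral_ge0 => t _; rewrite lee_fin mulr_ge0 ?powR_ge0 ?expR_ge0.
Qed.

Lemma beta_integral_ge0 x y : (0 <= beta_integral x y)%E.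
Proof. by apply: integral_ge0 => t _; rewrite lee_fin mulr_ge0 ?powR_ge0. Qed.

(** Both sides are the integral of [(s - t) ^ (x - 1) * t ^ (y - 1) * exp (- s)]
    over [0 < t < s]: for fixed [t] a shift gives a Gamma integral, and for fixed
    [s] scaling gives a Beta integral. *)
Lemma gamma_beta_integral x y :
  (gamma_integral x * gamma_integral y =
   beta_integral x y * gamma_integral (x + y))%E.
Proof.
pose h (z : measurableTypeR R * measurableTypeR R) : R :=
  if (0 < z.2) && (z.2 < z.1)
  then (z.1 - z.2) `^ (x - 1) * z.2 `^ (y - 1) * expR (- z.1) else 0.
have mh : measurable_fun [set: measurableTypeR R * measurableTypeR R] h.
  apply: measurable_fun_ifT.
  - apply: measurable_and; apply: measurable_fun_ltr => //.
  - apply: measurable_funM; first apply: measurable_funM.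
    + by apply: measurable_comp_powR; apply: measurable_funB.
    + exact: measurable_comp_powR.
    + by apply: (measurableT_comp (@measurable_expR R)); exact: measurable_funN.
  - exact: measurable_cst.
have h0 w : (0 <= (h w)%:E)%E.
  by rewrite lee_fin /h; case: ifP => // _; rewrite !mulr_ge0 ?powR_ge0 ?expR_ge0.
have := @fubini_tonelli _ _ _ _ _ leb leb (EFin \o h).
move=> /(_ ltac:(exact/measurable_EFinP) h0) /=.
have -> : (\int[leb]_s \int[leb]_t (h (s, t))%:E =
           beta_integral x y * gamma_integral (x + y))%E.
  transitivity (\int[leb]_(s in `]0%R, +oo[) (beta_integral x y *
     (s `^ (x + y - 1) * expR (- s))%:E))%E; last first.
    rewrite ge0_integralZl//.
    - by apply/measurable_EFinP; exact: measurable_gamma_integrand.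
    - by move=> s _; rewrite lee_fin mulr_ge0 ?powR_ge0 ?expR_ge0.
    - exact: beta_integral_ge0.
  rewrite [RHS]integral_mkcond; apply: eq_integral => s _.
  rewrite patchE; case: ifPn => [|/negP].
    rewrite inE/= in_itv/= andbT => s0.
    have -> : (\int[leb]_t (h (s, t))%:E = \int[leb]_(t in `]0%R, s[)
        ((s - t) `^ (x - 1) * t `^ (y - 1) * expR (- s))%:E)%E.
      apply: (@integral_if _ _ R leb `]0, s[%classic
        (fun t => (0 < t) && (t < s))) => t; by rewrite /= in_itv.
    have := integral_beta_itv x y s0; rewrite subr0 => Hb.
    rewrite EFinM muleA [(beta_integral _ _ * _)%E]muleC -Hb.
    rewrite -ge0_integralZr; last 4 first.
    - exact: measurable_itv.
    - apply/measurable_EFinP; apply: measurable_funM; apply: measurable_comp_powR;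
        exact: measurable_funB.
    - by move=> t _; rewrite lee_fin mulr_ge0 ?powR_ge0.
    - by rewrite lee_fin expR_ge0.
    by apply: eq_integral => t _; rewrite subr0 -EFinM.
  rewrite inE/= in_itv/= andbT => /negP; rewrite -leNgt => s0.
  rewrite integral0_eq// => t _; rewrite /h/=; case: ifPn => // /andP[t0 ts].
  by have := lt_le_trans (lt_trans t0 ts) s0; rewrite ltxx.
move=> ->.
transitivity (\int[leb]_(t in `]0%R, +oo[) (gamma_integral x *
     (t `^ (y - 1) * expR (- t))%:E))%E.
  rewrite ge0_integralZl//.
  - by apply/measurable_EFinP; exact: measurable_gamma_integrand.
  - by move=> s _; rewrite lee_fin mulr_ge0 ?powR_ge0 ?expR_ge0.
  - exact: gamma_integral_ge0.
rewrite integral_mkcond; apply: eq_integral => t _.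
rewrite patchE; case: ifPn => [|/negP].
  rewrite inE/= in_itv/= andbT => t0.
  have -> : (\int[leb]_s (h (s, t))%:E = \int[leb]_(s in `]t, +oo[)
      ((s - t) `^ (x - 1) * t `^ (y - 1) * expR (- s))%:E)%E.
    apply: (@integral_if _ _ R leb `]t, +oo[%classic
      (fun s => (0 < t) && (t < s))) => s; by rewrite /= in_itv/= andbT t0.
  rewrite /gamma_integral.
  pose g (s : R) : \bar R := (s `^ (x - 1) * expR (- s))%:E.
  rewrite -(@ge0_integral_shift R g t); last 2 first.
  - by apply/measurable_EFinP; exact: measurable_gamma_integrand.
  - by move=> s; rewrite lee_fin mulr_ge0 ?powR_ge0 ?expR_ge0.
  rewrite -ge0_integralZr; last 4 first.
  - exact: measurable_itv.
  - apply/measurable_EFinP; apply: measurable_funM.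
      by apply: measurable_comp_powR; exact: measurable_funB.
    apply: (measurableT_comp (@measurable_expR R)); apply: measurable_funN.
    exact: measurable_funB.
  - by move=> s _; rewrite lee_fin mulr_ge0 ?powR_ge0 ?expR_ge0.
  - by rewrite lee_fin mulr_ge0 ?powR_ge0 ?expR_ge0.
  apply: eq_integral => s _; rewrite /g -EFinM; congr EFin.
  rewrite -!mulrA; congr (_ * _); rewrite [LHS]mulrCA; congr (_ * _).
  by rewrite -expRD; congr expR; ring.
rewrite inE/= in_itv/= andbT => t0.
rewrite integral0_eq// => s _; rewrite /h/=; case: ifPn => // /andP[t0' _].
by rewrite t0' in t0.
Qed.

End GammaBeta.

Section Gamma.
Context {R : realType}.
Local Notation leb := (@lebesgue_measure R).
Local Notation lambda := (@completed_lebesgue_measure R).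
Implicit Types (x y z a b : R).

(** Substituting [u = t ^ z] maps [z * t ^ (z - 1)] on the unit interval to the
    constant [1]. *)
Lemma gamma_integral_near0 z : 0 < z ->
  (\int[leb]_(t in `]0%R, 1%R[) (t `^ (z - 1) * expR (- t))%:E < +oo)%E.
Proof.
move=> z0.
have F0 : (0 : R) `^ z = 0 by rewrite powR0 ?gt_eqF.
have E : (\int[leb]_(t in `]0%R, 1%R[) (z * t `^ (z - 1))%:E = 1)%E.
  have := @ge0_integration_by_substitution_oo R (fun t => t `^ z)
    (fun t => z * t `^ (z - 1)) (fun=> 1) 0 1 ltr01.
  rewrite F0 powR1 integral_cst//= lebesgue_measure_itv/= lte_fin ltr01.
  rewrite sube0 mule1 => h; rewrite [RHS]h.
  - by apply: eq_integral => t _; rewrite mul1r.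
  - apply: derivable_oo_LRcontinuous_within; split.
    + move=> t; rewrite in_itv/= => /andP[t0 _].
      by have /@ex_derive := is_derive1_powR z t0.
    + by rewrite F0; exact: powR_cvg0.
    + by apply: cvg_at_left_filter; exact: continuous_powR_gt0.
  - by move=> t; rewrite in_itv/= => /andP[t0 _]; exact: is_derive1_powR.
  - move=> t; rewrite in_itv/= => /andP[t0 _].
    apply: (@continuousM R R (fun=> z) (fun s : R => s `^ (z - 1))).
      exact: cst_continuous.
    exact: continuous_powR_gt0.
  - by move=> t; rewrite in_itv/= => /andP[t0 _]; rewrite mulr_gt0// powR_gt0.
  - by move=> t _; exact: cst_continuous.
  - by move=> t _.
apply: (@le_lt_trans _ _ (\int[leb]_(t in `]0%R, 1%R[)
    ((z^-1)%:E * (z * t `^ (z - 1))%:E))%E); last first.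
  rewrite ge0_integralZl_EFin//.
  - by rewrite E mule1 ltry.
  - by move=> t _; rewrite lee_fin mulr_ge0 ?powR_ge0// ltW.
  - by apply/measurable_EFinP; apply: measurable_funM => //; exact: measurable_comp_powR.
  - by rewrite invr_ge0 ltW.
apply: ge0_le_integral => //.
- by move=> t _; rewrite lee_fin mulr_ge0 ?powR_ge0 ?expR_ge0.
- by apply/measurable_EFinP; exact: measurable_gamma_integrand.
- apply: emeasurable_funM => //; apply/measurable_EFinP.
  by apply: measurable_funM => //; exact: measurable_comp_powR.
- move=> t; rewrite /= in_itv/= => /andP[t0 _].
  rewrite -EFinM lee_fin mulKf ?gt_eqF// ler_piMr ?powR_ge0//.
  by rewrite -expR0 ler_expR oppr_le0 ltW.
Qed.

(** One term of the exponential series dominates the power. Spending only half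
    of the exponent leaves [exp (- t / 2)] as a majorant of the Gamma
    integrand. *)
Lemma powR_le_expR_half z : exists C : R, 0 <= C /\
  forall t : R, 1 <= t -> t `^ z <= C * expR (t / 2).
Proof.
have [n zn] : exists n, z <= n.+1%:R.
  exists (Num.truncn z); exact/ltW/truncnS_gt.
exists (n.+1`!%:R * 2 ^+ n.+1); split => [|t t1]; first by rewrite mulr_ge0// exprn_ge0.
have t0 : 0 <= t by rewrite (le_trans _ t1).
apply: (@le_trans _ _ (t ^+ n.+1)).
  by rewrite -powR_mulrn// ler_powR.
have := @expR_ge1Dxn R (t / 2) n (divr_ge0 t0 _).
move=> /(_ ltac:(by [])) h.
have f0 : 0 < (n.+1)`!%:R :> R by rewrite ltr0n fact_gt0.
have : (t / 2) ^+ n.+1 / (n.+1)`!%:R <= expR (t / 2) by lra.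
rewrite ler_pdivrMr// expr_div_n ler_pdivrMr ?exprn_gt0// => h2.
by rewrite (le_trans h2)// mulrC mulrA mulrAC [_ ^+ _ * _]mulrC.
Qed.

Lemma gamma_integral_tail z :
  (\int[leb]_(t in `[1%R, +oo[) (t `^ (z - 1) * expR (- t))%:E < +oo)%E.
Proof.
have [C [C0 hC]] := powR_le_expR_half (z - 1).
have h0 : 0 < (2^-1 : R) by rewrite invr_gt0.
have mpdf := @measurable_exponential_pdf R 2^-1.
have pdf0 t := @exponential_pdf_ge0 R 2^-1 (ltW h0) t.
apply: (@le_lt_trans _ _ (\int[leb]_(t in `[1%R, +oo[)
   ((C * 2)%:E * (exponential_pdf (2^-1) t)%:E))%E).
  apply: ge0_le_integral => //.
  - by move=> t _; rewrite lee_fin mulr_ge0 ?powR_ge0 ?expR_ge0.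
  - by apply/measurable_EFinP; exact: measurable_gamma_integrand.
  - apply: emeasurable_funM => //; apply/measurable_EFinP.
    exact: measurable_funS mpdf.
  - move=> t; rewrite /= in_itv/= andbT => t1.
    rewrite -EFinM lee_fin exponential_pdfE; last by rewrite (le_trans _ t1).
    rewrite mulrA -[C * 2 * _]mulrA divff// mulr1.
    apply: (@le_trans _ _ (C * expR (t / 2) * expR (- t))).
      by rewrite ler_wpM2r ?expR_ge0// hC.
    by rewrite -mulrA -expRD ler_wpM2l// ler_expR; lra.
rewrite ge0_integralZl_EFin//; last 3 first.
- by move=> t _; rewrite lee_fin.
- by apply/measurable_EFinP; exact: measurable_funS mpdf.
- by rewrite mulr_ge0.
rewrite lte_mul_pinfty ?lee_fin ?mulr_ge0//.
apply: (@le_lt_trans _ _ (\int[leb]_t (exponential_pdf (2^-1) t)%:E)%E).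
  apply: ge0_subset_integral => //; first exact/measurable_EFinP.
  by move=> t _; rewrite lee_fin.
by rewrite integral_exponential_pdf// ltry.
Qed.

Lemma gamma_integral_lty z : 0 < z -> (gamma_integral z < +oo)%E.
Proof.
move=> z0; rewrite /gamma_integral.
have -> : `]0%R, +oo[%classic = `]0%R, 1%R[%classic `|` `[1%R, +oo[%classic :> set R.
  apply/seteqP; split => t /=; rewrite !in_itv/= ?andbT.
    by move=> t0; have [t1|t1] := ltP t 1; [left; rewrite t0|right].
  by case=> [/andP[]//|]; exact: lt_le_trans.
rewrite ge0_integral_setU//.
- by rewrite lte_add_pinfty// ?gamma_integral_near0 ?gamma_integral_tail.
- by apply/measurable_EFinP; exact: measurable_gamma_integrand.
- by move=> t _; rewrite lee_fin mulr_ge0 ?powR_ge0 ?expR_ge0.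
- apply/disj_setPS => t [] /=; rewrite !in_itv/= andbT => /andP[_ t1].
  by rewrite leNgt t1.
Qed.

(** On the interval from [1] to [2] the integrand is at least
    [2 ^ (- |z - 1|) * exp (- 2)]. *)
Lemma gamma_integral_gt0 z : (0 < gamma_integral z)%E.
Proof.
pose n := `|z - 1|.
pose c := (2 `^ n)^-1 * expR (- 2) : R.
have c0 : 0 < c by rewrite mulr_gt0 ?invr_gt0 ?powR_gt0 ?expR_gt0.
apply: (@lt_le_trans _ _ c%:E); first by rewrite lte_fin.
apply: (@le_trans _ _ (\int[leb]_(t in `]1%R, 2%R[) c%:E)%E).
  rewrite integral_cst//= lebesgue_measure_itv/= lte_fin ltr1n -EFinB -EFinM lee_fin.
  by lra.
apply: (@le_trans _ _ (\int[leb]_(t in `]1%R, 2%R[) (t `^ (z - 1) * expR (- t))%:E)%E).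
  apply: ge0_le_integral => //.
  - by move=> t _; rewrite lee_fin ltW.
  - by apply/measurable_EFinP; exact: measurable_gamma_integrand.
  move=> t; rewrite /= in_itv/= => /andP[t1 t2]; rewrite lee_fin.
  apply: ler_pM; rewrite ?invr_ge0 ?powR_ge0 ?expR_ge0//; last first.
    by rewrite ler_expR lerN2 ltW.
  apply: (@le_trans _ _ (t `^ (- n))); last first.
    rewrite ler_powR ?(ltW t1)//.
    by have := lexx n; rewrite {1}/n ler_norml => /andP[].
  have t0 : 0 < t by rewrite (lt_trans _ t1).
  rewrite powRN lef_pV2 ?posrE ?powR_gt0// ge0_ler_powR ?nnegrE ?normr_ge0 ?ltW//.
apply: ge0_subset_integral => //.
- by apply/measurable_EFinP; exact: measurable_gamma_integrand.
- by move=> t _; rewrite lee_fin mulr_ge0 ?powR_ge0 ?expR_ge0.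
- by move=> t /=; rewrite !in_itv/= andbT => /andP[t1 _]; rewrite (lt_trans _ t1).
Qed.

Lemma measurable_id_completed :
  measurable_fun [set: lebesgueType R] (id : lebesgueType R -> measurableTypeR R).
Proof.
move=> _ A mA; rewrite setTI; apply: sub_caratheodory; exact: mA.
Qed.

(** The identity, from Lebesgue measurable to Borel sets, pushes the completed
    measure forward to the Borel one. *)
Lemma ge0_integral_completed (D : set R) (h : R -> \bar R) :
  measurable D -> measurable_fun D h -> (forall t, D t -> 0 <= h t)%E ->
  (\int[lambda]_(t in (D : set (lebesgueType R))) h t = \int[leb]_(t in D) h t)%E.
Proof.
move=> mD mh h0.
have := @ge0_integral_pushforward _ _ (lebesgueType R) (measurableTypeR R) R id
  measurable_id_completed lambda D h mD mh.
rewrite preimage_id => <-; last by move=> t; rewrite inE; exact: h0.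
apply: eq_measure_integral => [|? A mA _]; first exact: measurable_id_completed.
by [].
Qed.

Lemma GammaE z : 0 < z -> (Gamma z)%:E = gamma_integral z.
Proof.
move=> z0; rewrite /Gamma /Rintegral.
rewrite (@ge0_integral_completed `]0%R, +oo[%classic); last 3 first.
- exact: measurable_itv.
- by apply/measurable_EFinP; exact: measurable_gamma_integrand.
- by move=> t _; rewrite lee_fin mulr_ge0 ?powR_ge0 ?expR_ge0.
by rewrite fineK// ge0_fin_numE ?gamma_integral_lty// gamma_integral_ge0.
Qed.

Lemma Gamma_gt0 z : 0 < z -> 0 < Gamma z.
Proof. by move=> z0; rewrite -lte_fin GammaE// gamma_integral_gt0. Qed.

(** Finiteness of the Beta integral also comes out of [gamma_beta_integral], as
    the Gamma integrals are finite and positive. *)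
Lemma beta_integralE x y : 0 < x -> 0 < y ->
  beta_integral x y = (Gamma x * Gamma y / Gamma (x + y))%:E.
Proof.
move=> x0 y0; have xy0 : 0 < x + y by rewrite addr_gt0.
have g0 := Gamma_gt0 xy0.
have := gamma_beta_integral x y; rewrite -!GammaE// => h.
have bfin : beta_integral x y \is a fin_num.
  rewrite ge0_fin_numE ?beta_integral_ge0// ltNge leye_eq; apply/eqP => byy.
  by move: h; rewrite byy gt0_mulye ?lte_fin// -EFinM.
move: h; rewrite -(fineK bfin) -!EFinM => -[->].
by rewrite mulfK ?gt_eqF.
Qed.

End Gamma.

(** * The kernel of the fractional integral *)

(** A bound that needs no case distinction on the sign of [r]. Applied to [- r]
    it bounds [t ^ r] from below. *)
Lemma powR_le_endpoints (R : realType) (a b t r : R) :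
  0 < a -> a <= t <= b -> t `^ r <= a `^ r + b `^ r.
Proof.
move=> a0 /andP[at_ tb].
have t0 : 0 < t by exact: lt_le_trans at_.
have b0 : 0 < b by exact: lt_le_trans tb.
have [r0|r0] := leP 0 r.
  apply: (@le_trans _ _ (b `^ r)); last by rewrite lerDr powR_ge0.
  by apply: ge0_ler_powR => //; rewrite nnegrE ltW.
apply: (@le_trans _ _ (a `^ r)); last by rewrite lerDl powR_ge0.
rewrite -(opprK r) !(powRN _ (- r)) lef_pV2 ?posrE ?powR_gt0//.
by apply: ge0_ler_powR => //; rewrite ?nnegrE ?oppr_ge0 ltW.
Qed.

Section FractionalKernel.
Context {R : realType}.
Local Notation leb := (@lebesgue_measure R).
Local Notation lambda := (@completed_lebesgue_measure R).
Context (rho a b : R).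
Hypotheses (a_gt0 : 0 < a) (rhoN1 : rho != -1).
Implicit Types (al be x t s : R).

Definition frac_weight al x t : R :=
  ((x `^ (rho + 1) - t `^ (rho + 1)) / (rho + 1)) `^ (al - 1) * t `^ rho.

(** Extended by [0] outside the triangle [a < t < x <= b], so that the operators
    integrate over, and act on functions of, the whole line. *)
Definition frac_kernel al (x t : lebesgueType R) : R :=
  if [&& (a : R) < t, t < (x : R) & (x : R) <= b] then frac_weight al x t else 0.

Let F t : R := t `^ (rho + 1) / (rho + 1).

Let rho1_neq0 : rho + 1 != 0. Proof. by rewrite addr_eq0. Qed.

Let FB x t : (x `^ (rho + 1) - t `^ (rho + 1)) / (rho + 1) = F x - F t.
Proof. by rewrite mulrBl. Qed.

Let is_derive_F t : 0 < t -> is_derive t 1 F (t `^ rho).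
Proof.
move=> t0; have h := is_derive1_powR (rho + 1) t0.
rewrite /F; apply: is_derive_eq.
by rewrite !scaler0 add0r addrK /GRing.scale/= mulKf.
Qed.

Let continuous_F s t : 0 < s -> {within `[s, t], continuous F}.
Proof.
move=> s0; apply: derivable_within_continuous => u.
rewrite in_itv/= => /andP[su _].
by have /@ex_derive := is_derive_F (lt_le_trans s0 su).
Qed.

Let lt_F s t : 0 < s -> s < t -> F s < F t.
Proof.
move=> s0 st; have : {in `[s, t] &, {homo F : x y / x < y}}.
  apply: gtr0_derive1_lt_cc (continuous_F s0) => u;
    rewrite in_itv/= => /andP[su _]; have u0 := lt_trans s0 su.
  - by have /@ex_derive := is_derive_F u0.
  - by rewrite derive1E; have /@derive_val -> := is_derive_F u0; rewrite powR_gt0.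
by apply => //; rewrite in_itv/= lexx ltW.
Qed.

Let le_F s t : 0 < s -> s <= t -> F s <= F t.
Proof. by move=> s0; rewrite le_eqVlt => /predU1P[->//|/(lt_F s0)/ltW]. Qed.

Let measurable_F : measurable_fun [set: R] F.
Proof. by apply: measurable_funM => //; exact: measurable_powR. Qed.

Lemma frac_kernel_ge0 al (x t : lebesgueType R) : 0 <= frac_kernel al x t.
Proof. by rewrite /frac_kernel; case: ifP => // _; rewrite mulr_ge0 ?powR_ge0. Qed.

Let frac_weightE al x t : frac_weight al x t = (F x - F t) `^ (al - 1) * t `^ rho.
Proof. by rewrite /frac_weight FB. Qed.

Lemma measurable_frac_kernel al :
  measurable_fun [set: lebesgueType R * lebesgueType R]
    (fun z => frac_kernel al z.1 z.2).
Proof.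
have m1 : measurable_fun [set: lebesgueType R * lebesgueType R]
    (fun z => z.1 : R).
  exact: (measurableT_comp measurable_id_completed measurable_fst).
have m2 : measurable_fun [set: lebesgueType R * lebesgueType R]
    (fun z => z.2 : R).
  exact: (measurableT_comp measurable_id_completed measurable_snd).
apply: measurable_fun_ifT.
- apply: measurable_and; first exact: measurable_fun_ltr.
  by apply: measurable_and; [exact: measurable_fun_ltr|exact: measurable_fun_ler].
- under eq_fun do rewrite frac_weightE.
  apply: measurable_funM; apply: measurable_comp_powR => //.
  by apply: measurable_funB; exact: (measurableT_comp measurable_F).
- exact: measurable_cst.
Qed.

Let measurable_beta_F al be x s : measurable_fun [set: R]
  (fun t : R => (F x - F t) `^ (al - 1) * (F t - F s) `^ (be - 1) * t `^ rho).
Proof.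
apply: measurable_funM; first apply: measurable_funM.
- by apply: measurable_comp_powR; exact: measurable_funB.
- by apply: measurable_comp_powR; exact: measurable_funB.
- exact: measurable_powR.
Qed.

(** The composition formula and, for one exponent equal to [1], both bounds of
    Schur's test are instances of this integral. *)
Let integral_beta_F al be s x : 0 < s -> s < x -> 0 < al -> 0 < be ->
  (\int[lambda]_(t in (`]s, x[%classic : set (lebesgueType R)))
      ((F x - F t) `^ (al - 1) * (F t - F s) `^ (be - 1) * t `^ rho)%:E =
   ((F x - F s) `^ (al + be - 1) * (Gamma al * Gamma be / Gamma (al + be)))%:E)%E.
Proof.
move=> s0 sx al0 be0.
rewrite (@ge0_integral_completed R `]s, x[%classic); last 3 first.
- exact: measurable_itv.
- by apply/measurable_EFinP; apply: measurable_funTS; exact: measurable_beta_F.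
- by move=> t _; rewrite lee_fin !mulr_ge0 ?powR_ge0.
have pos t : t \in `]s, x[ -> 0 < t.
  by rewrite in_itv/= => /andP[st _]; exact: lt_trans st.
rewrite (@integral_beta_substitution R F (fun t => t `^ rho) al be s x sx
  (continuous_F s0) (fun t tsx => is_derive_F (pos t tsx))); first last.
- by move=> t /pos t0; rewrite powR_gt0.
- by move=> t /pos; exact: continuous_powR_gt0.
by rewrite beta_integralE.
Qed.

Lemma frac_kernel_comp al be (x s : lebesgueType R) : 0 < al -> 0 < be ->
  (\int[lambda]_t (frac_kernel al x t * frac_kernel be t s)%:E =
   ((Gamma al * Gamma be / Gamma (al + be)) * frac_kernel (al + be) x s)%:E)%E.
Proof.
move=> al0 be0; rewrite [frac_kernel (al + be) x s]/frac_kernel.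
have [|asxb] := ifPn; last first.
  rewrite mulr0 integral0_eq// => t _; rewrite /frac_kernel.
  have [/and3P[_ tx xb]|_] := ifPn; last by rewrite mul0r.
  have [/and3P[as_ st _]|_] := ifPn; last by rewrite mulr0.
  by move: asxb; rewrite as_ xb (lt_trans st tx).
move=> /and3P[as_ sx xb].
have s0 : 0 < (s : R) by exact: lt_trans as_.
transitivity (\int[lambda]_t (if ((s : R) < t) && (t < (x : R)) then
   ((F x - F t) `^ (al - 1) * (F t - F s) `^ (be - 1) * t `^ rho) * s `^ rho
   else 0)%:E)%E.
  apply: eq_integral => t _; rewrite /frac_kernel xb as_ !andbT/=.
  case: (ltP (s : R) t) => st /=; last by rewrite mulr0.
  case: (ltP (t : R) x) => tx /=; last by rewrite andbF mul0r.
  rewrite (lt_trans as_ st) (le_trans (ltW tx) xb)/= !frac_weightE.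
  by rewrite mulrACA mulrA.
rewrite (@integral_if _ _ _ _ (`]s, x[%classic : set (lebesgueType R))
   (fun t => ((s : R) < t) && (t < (x : R)))); last first.
  by move=> t; rewrite /= in_itv.
under eq_integral do rewrite EFinM.
rewrite ge0_integralZr.
- rewrite (integral_beta_F s0 sx al0 be0) -EFinM frac_weightE.
  by congr EFin; rewrite [RHS]mulrCA [RHS]mulrA.
- by apply: sub_caratheodory; exact: measurable_itv.
- apply/measurable_EFinP; apply: measurable_funTS.
  exact: (measurableT_comp (measurable_beta_F _ _ _ _) measurable_id_completed).
- by move=> t _; rewrite lee_fin !mulr_ge0 ?powR_ge0.
- by rewrite lee_fin powR_ge0.
Qed.

Let gF al be : 0 < al -> 0 < be -> 0 <= Gamma al * Gamma be / Gamma (al + be).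
Proof. by move=> ? ?; rewrite mulr_ge0 ?invr_ge0 ?mulr_ge0 ?ltW ?Gamma_gt0 ?addr_gt0. Qed.

Let le_powR_F al s x : 0 < al -> a <= s -> s <= x -> x <= b ->
  (F x - F s) `^ al <= (F b - F a) `^ al.
Proof.
move=> al0 as_ sx xb; have s0 := lt_le_trans a_gt0 as_.
have x0 := lt_le_trans s0 sx.
apply: ge0_ler_powR; rewrite ?(ltW al0) ?nnegrE ?subr_ge0 ?le_F//.
- exact: le_trans (le_trans sx xb).
- by rewrite lerB// le_F.
Qed.

Lemma frac_kernel_row al (x : lebesgueType R) : 0 < al ->
  (\int[lambda]_t (frac_kernel al x t)%:E <=
   ((F b - F a) `^ al * (Gamma al * Gamma 1 / Gamma (al + 1)))%:E)%E.
Proof.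
move=> al0; have [xab|xab] := boolP ((a < (x : R)) && ((x : R) <= b)); last first.
  rewrite integral0_eq => [|t _].
    by rewrite lee_fin; apply: mulr_ge0; [exact: powR_ge0|exact: gF].
  rewrite /frac_kernel; case: ifP => // /and3P[at_ tx xb].
  by rewrite (lt_trans at_ tx) xb in xab.
have /andP[ax xb] := xab.
rewrite (_ : \int[lambda]_t _ =
    \int[lambda]_(t in (`]a, (x : R)[%classic : set (lebesgueType R)))
      ((F x - F t) `^ (al - 1) * (F t - F a) `^ (1 - 1) * t `^ rho)%:E)%E; last first.
  have PD (t : lebesgueType R) :
      (a < (t : R)) && ((t : R) < x) <-> (`]a, (x : R)[%classic : set R) t.
    by rewrite /= in_itv.
  rewrite -(integral_if _ _ PD).
  apply: eq_integral => t _; rewrite /frac_kernel xb andbT.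
  by case: ifP => // _; rewrite frac_weightE subrr powRr0 mulr1.
have /eqP := integral_beta_F a_gt0 ax al0 ltr01.
rewrite eq_le => /andP[+ _] => /le_trans; apply.
rewrite lee_fin addrK; apply: ler_wpM2r; first exact: gF.
by apply: le_powR_F => //; exact: ltW.
Qed.

(** The integral in [x] of a power of [F x - F t] is explicit only with the
    factor [F' x = x ^ rho]; on [a, b] the constant [t ^ rho] is comparable to
    it. *)
Lemma frac_kernel_col al (t : lebesgueType R) : 0 < al ->
  (\int[lambda]_x (frac_kernel al x t)%:E <=
   ((a `^ rho + b `^ rho) * (a `^ (- rho) + b `^ (- rho)) *
    ((F b - F a) `^ al * (Gamma 1 * Gamma al / Gamma (1 + al))))%:E)%E.
Proof.
move=> al0.
set C := (_ + _) * (_ + _).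
have C0 : 0 <= C by rewrite mulr_ge0// addr_ge0// powR_ge0.
have [tab|tab] := boolP ((a < (t : R)) && ((t : R) < b)); last first.
  rewrite integral0_eq => [|x _].
    by rewrite lee_fin mulr_ge0// mulr_ge0 ?powR_ge0// gF.
  rewrite /frac_kernel; case: ifP => // /and3P[at_ tx xb].
  by rewrite at_ (lt_le_trans tx xb) in tab.
have /andP[at_ tb] := tab; have t0 := lt_trans a_gt0 at_.
pose h (x : R) : R := (F b - F x) `^ (1 - 1) * (F x - F t) `^ (al - 1) * x `^ rho.
have mh : measurable_fun [set: R] h by exact: measurable_beta_F.
have h0 x : 0 <= h x by rewrite !mulr_ge0 ?powR_ge0.
have mtb : measurable (`](t : R), b]%classic : set (lebesgueType R)).
  by apply: sub_caratheodory; exact: measurable_itv.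
have mhl : measurable_fun (`](t : R), b]%classic : set (lebesgueType R)) h.
  by apply: measurable_funTS; exact: (measurableT_comp mh measurable_id_completed).
rewrite EFinM (@le_trans _ _ (C%:E *
    \int[lambda]_(x in (`](t : R), b]%classic : set (lebesgueType R)))
      (h x)%:E)%E)//.
  have hE0 (x : lebesgueType R) :
      (`](t : R), b]%classic : set R) x -> (0 <= (h x)%:E)%E by rewrite lee_fin.
  have mhE : measurable_fun (`](t : R), b]%classic : set (lebesgueType R))
    (fun x : lebesgueType R => (h x)%:E) by exact/measurable_EFinP.
  rewrite -(ge0_integralZl_EFin _ mtb hE0 mhE C0).
  have PD (x : lebesgueType R) :
      ((t : R) < x) && ((x : R) <= b) <-> (`](t : R), b]%classic : set R) x.
    by rewrite /= in_itv.
  under [leRHS]eq_integral do rewrite -EFinM.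
  rewrite -(integral_if _ _ PD).
  apply: ge0_le_integral; first exact: measurableT.
  - by move=> x _; rewrite lee_fin frac_kernel_ge0.
  - apply/measurable_EFinP.
    exact: (measurableT_comp (measurable_frac_kernel al) (pair2_measurable t)).
  - apply/measurable_EFinP; apply: measurable_fun_ifT.
    + apply: measurable_and.
        exact: (measurable_fun_ltr _ measurable_id_completed).
      exact: (measurable_fun_ler measurable_id_completed).
    + apply: measurable_funM; first exact: measurable_cst.
      exact: (measurableT_comp mh measurable_id_completed).
    + exact: measurable_cst.
  - move=> x _; rewrite lee_fin /frac_kernel at_ /=; case: ifP => // /andP[tx xb].
    rewrite frac_weightE /h subrr powRr0 mul1r /C [leRHS]mulrCA ler_wpM2l ?powR_ge0//.
    have x0 := lt_trans t0 tx.
    rewrite -mulrA -[leLHS]mulr1 ler_pM ?powR_ge0//.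
      by rewrite powR_le_endpoints// (ltW at_) (ltW tb).
    rewrite -(mulVf (lt0r_neq0 (powR_gt0 rho x0))) -powRN ler_wpM2r ?powR_ge0//.
    by rewrite powR_le_endpoints// xb (ltW (lt_trans at_ tx)).
apply: lee_wpmul2l; first by rewrite lee_fin.
rewrite (@ge0_integral_completed R `](t : R), b]%classic); last 3 first.
- exact: measurable_itv.
- by apply/measurable_EFinP; exact: measurable_funTS.
- by move=> x _; rewrite lee_fin.
rewrite -(@integral_itv_bndo_bndc R (BRight (t : R)) b (EFin \o h)); last first.
  by apply/measurable_EFinP; exact: measurable_funTS.
rewrite -(@ge0_integral_completed R `](t : R), b[%classic (EFin \o h)); last 3 first.
- exact: measurable_itv.
- by apply/measurable_EFinP; exact: measurable_funTS.
- by move=> x _; rewrite lee_fin.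
have /eqP := integral_beta_F t0 tb ltr01 al0.
rewrite eq_le => /andP[+ _] => /le_trans; apply.
rewrite lee_fin (addrC 1 al) addrK; apply: ler_wpM2r.
  by rewrite addrC gF.
by apply: le_powR_F => //; exact: ltW.
Qed.

Lemma frac_kernel_schur al : 0 < al ->
  exists M, schur_kernel lambda (frac_kernel al) M.
Proof.
move=> al0.
pose M1 := (F b - F a) `^ al * (Gamma al * Gamma 1 / Gamma (al + 1)).
pose M2 := (a `^ rho + b `^ rho) * (a `^ (- rho) + b `^ (- rho)) *
    ((F b - F a) `^ al * (Gamma 1 * Gamma al / Gamma (1 + al))).
have M10 : 0 <= M1 by apply: mulr_ge0; [exact: powR_ge0|exact: gF].
have M20 : 0 <= M2.
  apply: mulr_ge0; first by rewrite mulr_ge0// addr_ge0// powR_ge0.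
  by apply: mulr_ge0; [exact: powR_ge0|exact: gF].
exists (M1 + M2 + 1); split.
- lra.
- exact: frac_kernel_ge0.
- exact: measurable_frac_kernel.
- move=> x; apply: (le_trans (frac_kernel_row x al0)); rewrite lee_fin -/M1; lra.
- move=> x; apply: (le_trans (frac_kernel_col x al0)); rewrite lee_fin -/M2; lra.
Qed.

End FractionalKernel.

(** * Real and imaginary parts *)

Local Open Scope complex_scope.

Definition part (R : realType) (i : bool) (z : R[i]) : R :=
  if i then complex.Im z else complex.Re z.

(** Extension by [0] outside [a, b] matches the support of [frac_kernel]; the
    domain carries the Lebesgue measurable sets. *)
Definition rpart (R : realType) (a b : R) (i : bool) (f : R -> R[i]) :
    lebesgueType R -> R :=
  (fun t : lebesgueType R => part i (f t)) \_ (`[a, b]%classic : set R).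

Section Parts.
Context {R : realType}.
Local Notation lambda := (@completed_lebesgue_measure R).
Local Notation normc := (@Normc.normc R).
Implicit Types (a b c r : R) (z : R[i]) (f : R -> R[i]).

Lemma part_realM i (k : R) z : part i (k%:C * z) = k * part i z.
Proof. by case: i z => -[x y] /=; rewrite mul0r ?addr0 ?subr0. Qed.

Lemma normr_part_le i z : `|part i z| <= normc z.
Proof.
case: z => x y; rewrite /part /= -sqrtr_sqr; case: i => /=;
  by rewrite ler_wsqrtr// ?lerDr ?lerDl sqr_ge0.
Qed.

Lemma normc_le_parts z : normc z <= `|part false z| + `|part true z|.
Proof.
case: z => x y; rewrite /part /=.
rewrite -[leRHS]ger0_norm ?addr_ge0// -sqrtr_sqr ler_wsqrtr//.
rewrite sqrrD !real_normK ?num_real//.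
by rewrite -addrA addrCA lerDr// mulrn_wge0// mulr_ge0.
Qed.

Lemma normc_realM (k : R) z : 0 <= k -> normc (k%:C * z) = k * normc z.
Proof.
move=> k0; rewrite Normc.normcM; congr (_ * _).
by rewrite /= expr0n/= addr0 sqrtr_sqr ger0_norm.
Qed.

Lemma normc_ge0 z : 0 <= normc z.
Proof. by case: z => x y; exact: sqrtr_ge0. Qed.

Lemma powRD_le (s t r : R) : 0 <= s -> 0 <= t -> 0 <= r ->
  (s + t) `^ r <= 2 `^ r * (s `^ r + t `^ r).
Proof.
move=> s0 t0 r0.
have h (u : R) : 0 <= u -> s + t <= 2 * u -> u `^ r <= s `^ r + t `^ r ->
    (s + t) `^ r <= 2 `^ r * (s `^ r + t `^ r).
  move=> u0 stu ur; apply: (@le_trans _ _ ((2 * u) `^ r)).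
    by apply: ge0_ler_powR => //; rewrite nnegrE ?addr_ge0 ?mulr_ge0.
  by rewrite powRM// ler_wpM2l ?powR_ge0.
have [st|ts] := leP s t.
  by apply: (h t) => //; [lra|rewrite lerDr powR_ge0].
by apply: (h s) => //; [lra|rewrite lerDl powR_ge0].
Qed.

Lemma cmeasurableP a b f :
  cmeasurable (`[a, b]%classic : set R) f <->
  forall i, measurable_fun [set: lebesgueType R] (rpart a b i f).
Proof.
have mD : measurable (`[a, b]%classic : set (lebesgueType R)).
  by apply: sub_caratheodory; exact: measurable_itv.
split=> [[mre mim] i|m].
  by apply/(measurable_restrictT _ mD); case: i.
split; first by apply/(measurable_restrictT _ mD); exact: (m false).
by apply/(measurable_restrictT _ mD); exact: (m true).
Qed.

Lemma rpartE a b i f (x : lebesgueType R) :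
  (x : R) \in `[a, b] -> rpart a b i f x = part i (f x).
Proof. by move=> xab; rewrite /rpart patchE mem_set. Qed.

Lemma rpart_out a b i f (x : lebesgueType R) :
  (x : R) \notin `[a, b] -> rpart a b i f x = 0.
Proof. by move=> xab; rewrite /rpart patchE memNset//; apply/negP. Qed.

Lemma measurable_normc a b f : cmeasurable (`[a, b]%classic : set R) f ->
  measurable_fun (`[a, b]%classic : set (lebesgueType R)) (fun t => normc (f t)).
Proof.
move=> [mre mim].
have -> : (fun t => normc (f t)) = (@Num.sqrt R) \o
    (fun t => complex.Re (f t) ^+ 2 + complex.Im (f t) ^+ 2).
  by apply/funext => t /=; case: (f t).
apply: measurableT_comp.
  by apply: continuous_measurable_fun; exact: sqrt_continuous.
by apply: measurable_funD; exact: measurable_funX.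
Qed.

(** On [a, b] the weight [t ^ c] is at most [M] and at least [1 / A], with [M]
    and [A] below, and [1 / t] lies between [1 / b] and [1 / a]. *)
Lemma XspaceP p c a b f : 0 < a -> a < b -> (1 <= p)%E ->
  Xspace p c a b f <->
  forall i, measurable_fun [set: lebesgueType R] (rpart a b i f) /\
            lp_finite lambda p (rpart a b i f).
Proof.
move=> a0 ab p1.
pose M := a `^ c + b `^ c; pose A := a `^ (- c) + b `^ (- c).
have M0 : 0 <= M by rewrite addr_ge0// powR_ge0.
have A0 : 0 <= A by rewrite addr_ge0// powR_ge0.
have wM t : t \in `[a, b] -> t `^ c <= M.
  by rewrite in_itv/=; exact: powR_le_endpoints.
have pos t : t \in `[a, b] -> 0 < t.
  by rewrite in_itv/= => /andP[at_ _]; exact: lt_le_trans at_.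
have wA t : t \in `[a, b] -> 1 <= A * t `^ c.
  move=> tab; rewrite -(mulVf (lt0r_neq0 (powR_gt0 c (pos _ tab)))) -powRN.
  rewrite ler_wpM2r ?powR_ge0//; move: tab; rewrite in_itv/=.
  exact: powR_le_endpoints.
have part_le i t : t \in `[a, b] -> `|part i (f t)| <= A * (t `^ c * normc (f t)).
  move=> tab; rewrite (le_trans (normr_part_le _ _))// mulrA.
  by rewrite ler_peMl ?normc_ge0// wA.
have norm_le t : t \in `[a, b] -> t `^ c * normc (f t) <=
    M * (`|part false (f t)| + `|part true (f t)|).
  by move=> tab; rewrite ler_pM ?powR_ge0 ?normc_ge0 ?wM// normc_le_parts.
have mD : measurable (`[a, b]%classic : set (lebesgueType R)).
  by apply: sub_caratheodory; exact: measurable_itv.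
case: p p1 => [r| |] p1; [|rewrite /lp_finite|by []]; last first.
  split=> [[mf fe] i|h].
    split; first exact: ((cmeasurableP a b f).1 mf i).
    move: fe; rewrite /Xnorm; set g := EFin \o _ => ge.
    have [C [C0 gC]] : exists C, 0 <= C /\
        {ae lambda, forall x : lebesgueType R, (g x <= C%:E)%E}.
      have := ess_sup_ge lambda g; move: ge; case: (ess_sup _ _) => [C||]// _ h.
        exists `|C|; split=> //; apply: filterS h => x /le_trans; apply.
        by rewrite lee_fin ler_norm.
      exists 0; split=> //; apply: filterS h => x /le_trans; apply.
      exact: leNye.
    exists (A * C); split; first exact: mulr_ge0.
    apply: (@filterS _ _ (ae_filter_ringOfSetsType lambda) _ _ _ gC) => x.
    rewrite /g /= lee_fin patchE.
    have [xab|xab] := boolP ((x : R) \in `[a, b]).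
      rewrite mem_set// rpartE// => gx.
      by rewrite (le_trans (part_le _ _ xab))// ler_wpM2l.
    by rewrite rpart_out// normr0 mulr_ge0.
  split; first by apply/cmeasurableP => i; exact: (h i).1.
  have [_ [C [C0 hC]]] := h false; have [_ [C' [C'0 hC']]] := h true.
  rewrite /Xnorm; apply: (@le_lt_trans _ _ (M * (C + C'))%:E); last exact: ltry.
  apply/ess_supP; apply: filterS2 hC hC' => x; rewrite lee_fin patchE.
  have [xab|xab] := boolP ((x : R) \in `[a, b]).
    rewrite mem_set// !rpartE// => h1 h2.
    by rewrite (le_trans (norm_le _ xab))// ler_wpM2l// lerD.
  rewrite memNset; last by apply/negP.
  by move=> _ _; exact: mulr_ge0 M0 (addr_ge0 C0 C'0).
rewrite /lp_finite; have {p1} r1 : 1 <= r by rewrite lee_fin in p1.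
have r0 : 0 < r by exact: lt_le_trans r1.
have ri0 : r^-1 != 0 by rewrite invr_eq0 gt_eqF.
pose g (t : R) := normc ((t `^ c)%:C * f t) `^ r / t.
have gE t : g t = (t `^ c * normc (f t)) `^ r / t.
  by rewrite /g normc_realM ?powR_ge0.
have g0 t : t \in `[a, b] -> 0 <= g t.
  by move=> tab; rewrite gE divr_ge0 ?powR_ge0// ltW// pos.
have mg : cmeasurable `[a, b]%classic f ->
    measurable_fun (`[a, b]%classic : set (lebesgueType R)) (g : lebesgueType R -> R).
  move=> mf.
  apply: (@eq_measurable_fun _ _ _ _ _
      (fun t : lebesgueType R => (t `^ c * normc (f t)) `^ r * t `^ (-1))).
    move=> t; rewrite inE/= => tab.
    by rewrite gE powR_inv1// ltW// pos.
  have mid : measurable_fun (`[a, b]%classic : set (lebesgueType R))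
      (fun t : lebesgueType R => (t : R)).
    by apply: measurable_funTS; exact: measurable_id_completed.
  apply: measurable_funM; last exact: measurable_comp_powR.
  apply: measurable_comp_powR; apply: measurable_funM.
    exact: measurable_comp_powR.
  exact: measurable_normc.
split=> [[mf fe] i|h].
  split; first exact: ((cmeasurableP a b f).1 mf i).
  have := lty_poweRy ri0 fe; rewrite -/g => gfin.
  pose K := A `^ r * b.
  have b0 : 0 < b by exact: lt_trans ab.
  have K0 : 0 <= K by rewrite mulr_ge0 ?powR_ge0// ltW.
  have mgD := mg mf.
  apply: (@le_lt_trans _ _ (\int[lambda]_x (K%:E *
      ((EFin \o g) \_ (`[a, b]%classic : set (lebesgueType R))) x))%E).
    apply: ge0_le_integral; first exact: measurableT.
    - by move=> x _; rewrite lee_fin powR_ge0.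
    - apply/measurable_EFinP; apply: measurable_powR_norm.
      exact: ((cmeasurableP a b f).1 mf i).
    - apply: emeasurable_funM; first exact: measurable_cst.
      by apply/(measurable_restrictT _ mD); exact/measurable_EFinP.
    - move=> x _; rewrite patchE.
      have [xab|xab] := boolP ((x : R) \in `[a, b]).
        rewrite mem_set// rpartE// -EFinM lee_fin gE /K.
        have x0 := pos _ xab.
        apply: (@le_trans _ _ ((A * (x `^ c * normc (f x))) `^ r)).
          apply: ge0_ler_powR; rewrite ?nnegrE ?(ltW r0) ?part_le//.
          by rewrite mulr_ge0// mulr_ge0 ?powR_ge0 ?normc_ge0.
        rewrite powRM ?mulr_ge0 ?powR_ge0 ?normc_ge0// -mulrA ler_wpM2l ?powR_ge0//.
        rewrite mulrCA ler_peMr ?powR_ge0// ler_pdivlMr// mul1r.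
        by move: xab; rewrite in_itv/= => /andP[].
      by rewrite memNset ?mule0 ?rpart_out ?normr0 ?powR0 ?gt_eqF//; apply/negP.
  have gD0 (x : lebesgueType R) : [set: lebesgueType R] x ->
      (0 <= ((EFin \o g) \_ (`[a, b]%classic : set (lebesgueType R))) x)%E.
    by move=> _; apply: erestrict_ge0 => t tab; rewrite lee_fin g0.
  have mgT : measurable_fun [set: lebesgueType R]
      ((EFin \o g) \_ (`[a, b]%classic : set (lebesgueType R))).
    by apply/(measurable_restrictT _ mD); exact/measurable_EFinP.
  rewrite (ge0_integralZl_EFin _ measurableT gD0 mgT K0).
  rewrite -integral_mkcond lte_mul_pinfty//.
have mf : cmeasurable `[a, b]%classic f by apply/cmeasurableP => i; exact: (h i).1.
split=> //.
rewrite /Xnorm; apply: poweR_lty; rewrite -/g.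
have [m0 l0] := h false; have [m1 l1] := h true.
pose v0 := rpart a b false f; pose v1 := rpart a b true f.
pose K := M `^ r * 2 `^ r / a.
have K0 : 0 <= K by rewrite divr_ge0 ?(ltW a0)// mulr_ge0 ?powR_ge0.
have mv0 := measurable_powR_norm r m0; have mv1 := measurable_powR_norm r m1.
have mv : measurable_fun [set: lebesgueType R]
    (fun x => (`|v0 x| `^ r)%:E + (`|v1 x| `^ r)%:E)%E.
  by apply: emeasurable_funD; apply/measurable_EFinP; [exact: mv0|exact: mv1].
have v_ge0 x : (0 <= (`|v0 x| `^ r)%:E + (`|v1 x| `^ r)%:E)%E.
  by rewrite -EFinD lee_fin addr_ge0 ?powR_ge0.
apply: (@le_lt_trans _ _ (\int[lambda]_(x in (`[a, b]%classic : set (lebesgueType R)))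
    (K%:E * ((`|v0 x| `^ r)%:E + (`|v1 x| `^ r)%:E)))%E).
  apply: ge0_le_integral; first exact: mD.
  - by move=> x xab; rewrite lee_fin g0.
  - by apply/measurable_EFinP; exact: mg.
  - apply: emeasurable_funM; first exact: measurable_cst.
    exact: (measurable_funTS mv).
  - move=> x /= xab; rewrite -EFinD -EFinM lee_fin -/(g x) gE /v0 /v1 !rpartE// /K.
    have x0 := pos _ xab.
    apply: (@le_trans _ _ ((M * (`|part false (f x)| + `|part true (f x)|)) `^ r / x)).
      rewrite ler_pM2r ?invr_gt0//.
      apply: ge0_ler_powR; rewrite ?nnegrE ?(ltW r0) ?norm_le//.
      by rewrite mulr_ge0 ?powR_ge0 ?normc_ge0.
      by rewrite (mulr_ge0 M0)// addr_ge0.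
    have P0 : 0 <= `|part false (f x)| + `|part true (f x)| by exact: addr_ge0.
    rewrite (powRM _ M0 P0) [leRHS]mulrAC; apply: ler_pM.
    - by rewrite mulr_ge0 ?powR_ge0.
    - by rewrite invr_ge0 ltW.
    - by rewrite -mulrA ler_wpM2l ?powR_ge0// powRD_le// ltW.
    by rewrite lef_pV2 ?posrE//; move: xab; rewrite in_itv/= => /andP[].
rewrite (ge0_integralZl_EFin _ mD (fun x _ => v_ge0 x) (measurable_funTS mv) K0).
apply: lte_mul_pinfty; [by rewrite lee_fin|by []|].
apply: (@le_lt_trans _ _ (\int[lambda]_x
    ((`|v0 x| `^ r)%:E + (`|v1 x| `^ r)%:E))%E).
  exact: ge0_subset_integral.
rewrite ge0_integralD; first exact: (lte_add_pinfty l0 l1).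
- exact: measurableT.
- by move=> x _; rewrite lee_fin powR_ge0.
- by apply/measurable_EFinP; exact: mv0.
- by move=> x _; rewrite lee_fin powR_ge0.
- by apply/measurable_EFinP; exact: mv1.
Qed.

End Parts.

(** * The fractional integral on the weighted spaces *)

(** Kept over an abstract field so that the values of [Gamma] are not unfolded by
    the arithmetic. *)
Lemma gamma_cancel (R : fieldType) (ga gb gab k k' : R) :
  ga != 0 -> gb != 0 -> gab != 0 ->
  gb * k = ga * gb / gab * k' -> ga^-1 * k = gab^-1 * k'.
Proof.
move=> ga0 gb0 gab0 e; apply: (mulfI gb0); rewrite mulrCA e.
by field; rewrite ga0 gab0.
Qed.

Section FractionalIntegral.
Context {R : realType}.
Local Notation lambda := (@completed_lebesgue_measure R).
Context (rho a b : R).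
Hypotheses (a_gt0 : 0 < a) (a_lt_b : a < b) (rhoN1 : rho != -1).
Implicit Types (al be c : R) (p : \bar R) (f : R -> R[i]).

Local Notation K := (frac_kernel rho a b).

(** The bridge to [kop]: the integrand over [a < t < x] is the kernel product on
    the whole line. *)
Lemma restrict_frac_integrand al f i (x : lebesgueType R) :
  (x : R) \in `[a, b] ->
  (EFin \o (fun t : lebesgueType R => part i (frac_integrand rho al f x t)))
    \_ (`]a, (x : R)[%classic : set R) =
  (fun t => (K al x t * rpart a b i f t)%:E).
Proof.
rewrite in_itv/= => /andP[_ xb]; apply/funext => t; rewrite patchE.
rewrite /frac_kernel xb andbT.
have [/andP[at_ tx]|axt] := boolP ((a < (t : R)) && ((t : R) < x)).
  rewrite mem_set/= ?in_itv/= ?at_// rpartE ?in_itv/= ?(ltW at_) ?(le_trans (ltW tx))//.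
  by rewrite part_realM.
by rewrite mul0r memNset//= in_itv/=; exact/negP.
Qed.

Lemma cintegrable_frac_integrand al f (x : lebesgueType R) :
  (x : R) \in `[a, b] ->
  (forall i, lambda.-integrable [set: lebesgueType R]
     (fun t => (K al x t * rpart a b i f t)%:E)) ->
  cintegrable `]a, (x : R)[ (frac_integrand rho al f x).
Proof.
move=> xab h.
have mD : measurable (`]a, (x : R)[%classic : set (lebesgueType R)).
  by apply: sub_caratheodory; exact: measurable_itv.
split; apply/(integrable_mkcond _ mD).
- by rewrite (restrict_frac_integrand al f false xab); exact: h.
- by rewrite (restrict_frac_integrand al f true xab); exact: h.
Qed.

Lemma part_frac_int al f i (x : lebesgueType R) : (x : R) \in `[a, b] ->
  part i (frac_int rho a al f x) =
  (Gamma al)^-1 * kop lambda (K al) (rpart a b i f) x.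
Proof.
move=> xab; rewrite /frac_int part_realM; congr (_ * _).
rewrite /kop /Rintegral -(restrict_frac_integrand al f i xab) -integral_mkcond.
by case: i.
Qed.

(** An equality of functions, not merely on [a, b], since both sides vanish
    outside; hence it can be iterated inside [kop]. *)
Lemma rpart_frac_int al f i : rpart a b i (frac_int rho a al f) =
  (fun x => (Gamma al)^-1 * kop lambda (K al) (rpart a b i f) x).
Proof.
apply/funext => x; have [xab|xab] := boolP ((x : R) \in `[a, b]).
  by rewrite rpartE// part_frac_int.
rewrite rpart_out// /kop /Rintegral integral0_eq ?mulr0// => t _.
rewrite /frac_kernel; case: ifP => [/and3P[at_ tx xb]|]; last by rewrite mul0r.
by move: xab; rewrite in_itv/= (ltW (lt_trans at_ tx)) xb.
Qed.

Lemma Xspace_integrable p c f i : (1 <= p)%E -> Xspace p c a b f ->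
  lambda.-integrable [set: lebesgueType R] (EFin \o rpart a b i f).
Proof.
move=> p1 /(XspaceP c f a_gt0 a_lt_b p1)/(_ i)[mv lv].
apply: (@lp_finite_integrable _ _ _ lambda p _
  (`[a, b]%classic : set (lebesgueType R))) => //.
- by apply: sub_caratheodory; exact: measurable_itv.
- suff : (lebesgue_measure (`[a, b]%classic : set R) < +oo)%E by [].
  by rewrite lebesgue_measure_itv/= lte_fin a_lt_b -EFinB ltry.
- by move=> x xab; rewrite rpart_out//; exact/negP.
Qed.

Lemma frac_int_defined_Xspace p c al f : 0 < al -> (1 <= p)%E ->
  Xspace p c a b f -> frac_int_defined rho a b al f.
Proof.
move=> al0 p1 Xf.
have [M sK] := frac_kernel_schur b a_gt0 rhoN1 al0.
have h i := ae_kernel_integrable sK (Xspace_integrable i p1 Xf).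
apply: (@filterS2 _ _ (ae_filter_ringOfSetsType lambda) _ _ _ _ (h false) (h true)).
by move=> x h0 h1 xab; apply: cintegrable_frac_integrand => //; case.
Qed.

Lemma Xspace_frac_int p c al f : 0 < al -> (1 <= p)%E ->
  Xspace p c a b f -> Xspace p c a b (frac_int rho a al f).
Proof.
move=> al0 p1 Xf.
have [M sK] := frac_kernel_schur b a_gt0 rhoN1 al0.
apply/(XspaceP c _ a_gt0 a_lt_b p1) => i.
have iv := Xspace_integrable i p1 Xf.
have [mv lv] := (XspaceP c f a_gt0 a_lt_b p1).1 Xf i.
have mk := measurable_kop sK iv.
rewrite rpart_frac_int; split; first exact: measurable_funM.
by apply: lp_finite_scale => //; exact: lp_finite_kop sK p1 iv lv.
Qed.

(** For each part, [kop_comp] composes the kernels and the factors [Gamma]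
    cancel. The inner factor [1 / Gamma be] moves out of the outer operator at
    the points where the outer integral converges, which is almost
    everywhere. *)
Lemma frac_int_semigroup p c al be f : 0 < al -> 0 < be -> (1 <= p)%E ->
  Xspace p c a b f ->
  ae_eq lambda (`[a, b]%classic : set (lebesgueType R))
    (frac_int rho a al (frac_int rho a be f)) (frac_int rho a (al + be) f).
Proof.
move=> al0 be0 p1 Xf; have ab0 : 0 < al + be by exact: addr_gt0.
have [M1 s1] := frac_kernel_schur b a_gt0 rhoN1 al0.
have [M2 s2] := frac_kernel_schur b a_gt0 rhoN1 be0.
have [M3 s3] := frac_kernel_schur b a_gt0 rhoN1 ab0.
have Ga := Gamma_gt0 al0; have Gb := Gamma_gt0 be0; have Gab := Gamma_gt0 ab0.
pose C := Gamma al * Gamma be / Gamma (al + be).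
have C0 : 0 <= C := divr_ge0 (mulr_ge0 (ltW Ga) (ltW Gb)) (ltW Gab).
have kcomp x y := frac_kernel_comp b a_gt0 rhoN1 x y al0 be0.
have h i : {ae lambda, forall x : lebesgueType R, (x : R) \in `[a, b] ->
    part i (frac_int rho a al (frac_int rho a be f) x) =
    part i (frac_int rho a (al + be) f x)}.
  have iv := Xspace_integrable i p1 Xf.
  have iw := Xspace_integrable i p1 (Xspace_frac_int be0 p1 Xf).
  have e1 := kop_comp s1 s2 s3 C0 kcomp iv.
  have e2 := ae_kernel_integrable s1 iw.
  apply: (@filterS2 _ _ (ae_filter_ringOfSetsType lambda) _ _ _ _ e1 e2).
  move=> x {}e1 {}e2 xab; rewrite !part_frac_int//.
  have vE : kop lambda (K be) (rpart a b i f) =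
      (fun t => Gamma be * rpart a b i (frac_int rho a be f) t).
    by apply/funext => t; rewrite rpart_frac_int (mulVKf (lt0r_neq0 Gb)).
  rewrite vE (kop_scale _ e2) in e1.
  exact: (gamma_cancel (lt0r_neq0 Ga) (lt0r_neq0 Gb) (lt0r_neq0 Gab) e1).
apply: (@filterS2 _ _ (ae_filter_ringOfSetsType lambda) _ _ _ _ (h false) (h true)).
move=> x h0 h1 xab; apply/eqP; rewrite eq_complex.
by rewrite (h0 xab : complex.Re _ = complex.Re _)
           (h1 xab : complex.Im _ = complex.Im _) !eqxx.
Qed.

End FractionalIntegral.

Theorem theorem4p1 (R : realType) (alpha beta : R) (p : \bar R)
    (a b rho c : R) (f : R -> R[i]) :
  0 < alpha -> 0 < beta -> (1 <= p)%E -> 0 < a -> a < b ->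
  rho != -1 -> c <= rho ->
  Xspace p c a b f ->
  [/\ frac_int_defined rho a b beta f,
      frac_int_defined rho a b alpha (frac_int rho a beta f)
    & frac_int_defined rho a b (alpha + beta) f] /\
  [/\ Xspace p c a b (frac_int rho a alpha (frac_int rho a beta f)),
      Xspace p c a b (frac_int rho a (alpha + beta) f)
    & ae_eq (@completed_lebesgue_measure R) [set` `[a, b]]
        (frac_int rho a alpha (frac_int rho a beta f))
        (frac_int rho a (alpha + beta) f)].
Proof.
move=> al0 be0 p1 a0 ab rho1 _ Xf; have ab0 := addr_gt0 al0 be0.
have Xbf := Xspace_frac_int a0 ab rho1 be0 p1 Xf.
split; split.
- exact: frac_int_defined_Xspace Xf.
- exact: frac_int_defined_Xspace Xbf.
- exact: frac_int_defined_Xspace Xf.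
- exact: Xspace_frac_int Xbf.
- exact: Xspace_frac_int Xf.
- exact: frac_int_semigroup Xf.
Qed.
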